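(* Let $\mathcal X_T=(X_1,\ldots,X_T)$ be given vectors in $\mathbb R^p$, $\epsilon>0$, $\lambda_1>0$, $\lambda_2>0$ and $\lambda_3\ge0.5$. Consider the primal problem $$\text{(P')}\quad\min_{\Theta_t\succeq\epsilon I_p,\ 1\le t\le T}\Big\{\sum_{t=1}^T\big[\mathrm{tr}(\tfrac12\Theta_t^2X_tX_t^\top)-\mathrm{tr}(\Theta_t)\big]+\lambda_1T\sum_{t=1}^T\|\Theta_t\|_{1,\mathrm{off}}+\lambda_2T\sum_{t=1}^{T-1}\mathcal R(\|\Theta_{t+1}-\Theta_t\|_F;\lambda_3)\Big\},$$ where $\mathcal R(x;\lambda_3)=|x|$ if $|x|\le\lambda_3$ and $\mathcal R(x;\lambda_3)=x^2-\lambda_3^2+\lambda_3$ otherwise. (i) Let $$\mathcal G(x;\lambda_3)=\min\Big\{-(x-\lambda_2T)_+\lambda_3,\ \lambda_2T\Big(\Big(\lambda_3-\frac{x}{2\lambda_2T}\Big)_+^2-\frac{x^2}{4\lambda_2^2T^2}-\lambda_3^2+\lambda_3\Big)\Big\},$$ where $(\cdot)_+=\max\{\cdot,0\}$. Then the dual problem of (P') is $$\text{(D')}\quad\begin{aligned}\max_{\mathbf Y}\quad&\sum_{t=1}^T-\tfrac12\mathrm{tr}(W_t^\top W_t)+\epsilon\sum_{t=1}^T\mathrm{tr}\big(Z_t-Z_{t-1}-I_p+(X_tX_t^\top)^{1/2}W_t-Y_{t,\mathrm{off}}\big)+\sum_{t=1}^{T-1}\mathcal G(\|Z_t\|_F;\lambda_3)\\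 \text{s.t.}\quad&Z_0=Z_T=\mathbf 0_{p\times p},\\&Z_t-Z_{t-1}-I_p+\mathrm{Sym}\big((X_tX_t^\top)^{1/2}W_t\big)-Y_{t,\mathrm{off}}\succeq0\quad\forall t=1,\ldots,T,\\&|Y_{uv,t}|\le\lambda_1T\quad\forall t=1,\ldots,T,\ u,v=1,\ldots,p\text{ with }u\ne v,\end{aligned}$$ where $\mathbf Y=\{\{W_t\}_{t=1}^T,\{Y_{t,\mathrm{off}}\}_{t=1}^T,\{Z_t\}_{t=1}^{T-1}\}$ is the dual variable, with $W_t\in\mathbb R^{p\times p}$, $Y_{t,\mathrm{off}}\in\mathcal S^p_{\mathrm{off}}$, $Z_t\in\mathcal S^p$ for all $t$. Moreover, (P') and (D') have the same optimal values. (ii) If $\sum_{t=1}^TX_tX_t^\top\succ0$, then the dual problem (D') has a Slater point and the primal problem (P') has optimal solutions.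
   Context: $\mathcal S^p$ is the set of symmetric $p\times p$ matrices; $\mathcal S^p_{\mathrm{off}}$ is the set of symmetric $p\times p$ matrices with zero diagonal; $Y_{uv,t}$ is the $(u,v)$ entry of $Y_{t,\mathrm{off}}$. $A\succeq B$ (resp. $A\succ B$) means $A,B$ are symmetric and $A-B$ is positive semi-definite (resp. positive definite). $\mathrm{Sym}(A)=(A+A^\top)/2$. $S^{1/2}$ is the unique positive semi-definite square root of a positive semi-definite $S$. $\|A\|_{1,\mathrm{off}}=\sum_{k\ne l}|A_{kl}|$; $\|\cdot\|_F$ is the Frobenius norm. ''Dual problem'' means the Lagrangian dual (with multipliers $W_t$, $Y_{t,\mathrm{off}}$, $Z_t$) of the equivalent form of (P') obtained by introducing auxiliary variables and the equality constraints $U_t=(X_tX_t^\top)^{1/2}\Theta_t$, $\Upsilon_{t,\mathrm{off}}=\Theta_{t,\mathrm{off}}$ (for $t=1,\ldots,T$) and $D_t=\Theta_{t+1}-\Theta_t$ (for $t=1,\ldots,T-1$), where $\Theta_{t,\mathrm{off}}$ is $\Theta_t$ with diagonal set to $0$, $\Upsilon_{t,\mathrm{off}}\in\mathcal S^p_{\mathrm{off}}$, $D_t\in\mathcal S^p$, $U_t\in\mathbb R^{p\times p}$; the objective becomes $\sum_t[\frac12\mathrm{tr}(U_t^\top U_t)-\mathrm{tr}(\Theta_t)+\delta_{\cdot\succeq\epsilon I_p}(\Theta_t)]+\lambda_1T\sum_t\|\Upsilon_{t,\mathrm{off}}\|_{1,\mathrm{off}}+\lambda_2T\sum_{t=1}^{T-1}\mathcal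 R(\|D_t\|_F;\lambda_3)$, with $\delta_{\cdot\succeq\epsilon I_p}$ the indicator function ($0$ on $\{S:S\succeq\epsilon I_p\}$, $+\infty$ elsewhere), and the Lagrangian subtracts $\langle W_t,U_t-(X_tX_t^\top)^{1/2}\Theta_t\rangle$, $\langle Y_{t,\mathrm{off}},\Theta_{t,\mathrm{off}}-\Upsilon_{t,\mathrm{off}}\rangle$, $\langle Z_t,\Theta_{t+1}-\Theta_t-D_t\rangle$. Optimal values are in $[-\infty,+\infty]$. A Slater point of (D') is a feasible point that satisfies all the inequality and positive semi-definite constraints strictly, i.e. satisfies every ''$\le$'' and ''$\succeq$'' as ''$<$'' and ''$\succ$'', respectively. *)

(* Defs.v *)
From HB Require Import structures.
From mathcomp Require Import all_boot all_order all_algebra.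
From mathcomp Require Import all_classical all_reals all_analysis.

Set Implicit Arguments.
Unset Strict Implicit.
Unset Printing Implicit Defensive.

Import Order.TTheory GRing.Theory Num.Theory.

Local Open Scope classical_set_scope.
Local Open Scope ring_scope.

Definition symmetric_mx (R : realType) (p : nat) (A : 'M[R]_p) : Prop :=
  A^T = A.

Definition sym_off_mx (R : realType) (p : nat) (A : 'M[R]_p) : Prop :=
  symmetric_mx A /\ forall i, A i i = 0.

(* A ⪰ B: both sides are required to be symmetric *)
Definition loewner_ge (R : realType) (p : nat) (A B : 'M[R]_p) : Prop :=
  [/\ symmetric_mx A, symmetric_mx B
    & forall x : 'cV[R]_p, 0 <= (x^T *m (A - B) *m x) 0 0].

Definition loewner_gt (R : realType) (p : nat) (A B : 'M[R]_p) : Prop :=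
  [/\ symmetric_mx A, symmetric_mx B
    & forall x : 'cV[R]_p, x != 0 -> 0 < (x^T *m (A - B) *m x) 0 0].

(* S^{1/2} for S ⪰ 0; the default value 0 of [xget] is only taken when S has no
   positive semi-definite square root. *)
Definition sqrt_mx (R : realType) (p : nat) (S : 'M[R]_p) : 'M[R]_p :=
  xget 0 [set B : 'M[R]_p | loewner_ge B 0 /\ B *m B = S].

Definition Sym_part (R : realType) (p : nat) (A : 'M[R]_p) : 'M[R]_p :=
  2^-1 *: (A + A^T).

Definition inner_mx (R : realType) (p : nat) (A B : 'M[R]_p) : R :=
  \tr (A^T *m B).

Definition frobenius (R : realType) (p : nat) (A : 'M[R]_p) : R :=
  Num.sqrt (\sum_i \sum_j A i j ^+ 2).

Definition norm1_off (R : realType) (p : nat) (A : 'M[R]_p) : R :=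
  \sum_k \sum_(l | k != l) `|A k l|.

Definition offdiag (R : realType) (p : nat) (A : 'M[R]_p) : 'M[R]_p :=
  \matrix_(i, j) if i == j then 0 else A i j.

Definition posp (R : realType) (x : R) : R := Num.max x 0.

Definition calR (R : realType) (lambda3 x : R) : R :=
  if `|x| <= lambda3 then `|x| else x ^+ 2 - lambda3 ^+ 2 + lambda3.

Definition calG (R : realType) (T : nat) (lambda2 lambda3 x : R) : R :=
  Num.min (- posp (x - lambda2 * T%:R) * lambda3)
    (lambda2 * T%:R *
      (posp (lambda3 - x / (2 * lambda2 * T%:R)) ^+ 2
       - x ^+ 2 / (4 * lambda2 ^+ 2 * T%:R ^+ 2)
       - lambda3 ^+ 2 + lambda3)).

(* Time t = 1..T is the ordinal t - 1 of 'I_T; an index t = 1..T-1 (of D_t or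
   Z_t) is the ordinal t - 1 of 'I_T.-1. *)
Lemma ltn_succ_pred (T : nat) (t : 'I_T.-1) : (t.+1 < T)%N.
Proof. by case: T t => [[]|T] //= t; rewrite ltnS. Qed.

Definition ord_cur (T : nat) (t : 'I_T.-1) : 'I_T := widen_ord (leq_pred T) t.
Definition ord_next (T : nat) (t : 'I_T.-1) : 'I_T := Ordinal (ltn_succ_pred t).

Section Problems.
Context {R : realType} {p T : nat}.

Definition diff_time (Theta : 'I_T -> 'M[R]_p) (t : 'I_T.-1) : 'M[R]_p :=
  Theta (ord_next t) - Theta (ord_cur t).

(* Z_k for k = 0..T, with 1-based k and Z_0 = Z_T = 0 *)
Definition zpad (Z : 'I_T.-1 -> 'M[R]_p) (k : nat) : 'M[R]_p :=
  if k is k'.+1 then oapp Z 0 (insub k') else 0.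

Definition zdiff (Z : 'I_T.-1 -> 'M[R]_p) (t : 'I_T) : 'M[R]_p :=
  zpad Z t.+1 - zpad Z t.

Definition primal_feasible (eps : R) (Theta : 'I_T -> 'M[R]_p) : Prop :=
  forall t, loewner_ge (Theta t) eps%:M.

Definition primal_obj (X : 'I_T -> 'cV[R]_p) (lambda1 lambda2 lambda3 : R)
    (Theta : 'I_T -> 'M[R]_p) : R :=
  \sum_(t < T) (\tr ((2^-1 *: (Theta t *m Theta t)) *m (X t *m (X t)^T))
                - \tr (Theta t))
  + lambda1 * T%:R * \sum_(t < T) norm1_off (Theta t)
  + lambda2 * T%:R *
      \sum_(t < T.-1) calR lambda3 (frobenius (diff_time Theta t)).

Definition primal_value (X : 'I_T -> 'cV[R]_p)
    (eps lambda1 lambda2 lambda3 : R) : \bar R :=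
  ereal_inf [set (primal_obj X lambda1 lambda2 lambda3 Theta)%:E
            | Theta in [set Theta | primal_feasible eps Theta]].

Definition primal_optimal (X : 'I_T -> 'cV[R]_p)
    (eps lambda1 lambda2 lambda3 : R) (Theta : 'I_T -> 'M[R]_p) : Prop :=
  primal_feasible eps Theta /\
  forall Theta', primal_feasible eps Theta' ->
    primal_obj X lambda1 lambda2 lambda3 Theta
      <= primal_obj X lambda1 lambda2 lambda3 Theta'.

Record lifted_var := LiftedVar {
  lTheta : 'I_T -> 'M[R]_p;
  lU : 'I_T -> 'M[R]_p;
  lUpsilon : 'I_T -> 'M[R]_p;
  lD : 'I_T.-1 -> 'M[R]_p }.

Definition lifted_dom (v : lifted_var) : Prop :=
  (forall t, sym_off_mx (lUpsilon v t)) /\ (forall t, symmetric_mx (lD v t)).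

Record dual_var := DualVar {
  dW : 'I_T -> 'M[R]_p;
  dY : 'I_T -> 'M[R]_p;
  dZ : 'I_T.-1 -> 'M[R]_p }.

Definition dual_dom (y : dual_var) : Prop :=
  (forall t, sym_off_mx (dY y t)) /\ (forall t, symmetric_mx (dZ y t)).

Definition indicator_ge (eps : R) (A : 'M[R]_p) : \bar R :=
  if `[< loewner_ge A eps%:M >] then 0%E else +oo%E.

Definition lifted_obj (eps lambda1 lambda2 lambda3 : R) (v : lifted_var) :
    \bar R :=
  (\sum_(t < T) ((2^-1 * \tr ((lU v t)^T *m lU v t) - \tr (lTheta v t))%:E
                 + indicator_ge eps (lTheta v t))
   + (lambda1 * T%:R * \sum_(t < T) norm1_off (lUpsilon v t))%:E
   + (lambda2 * T%:R *
        \sum_(t < T.-1) calR lambda3 (frobenius (lD v t)))%:E)%E.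

Definition lagrangian (X : 'I_T -> 'cV[R]_p) (eps lambda1 lambda2 lambda3 : R)
    (v : lifted_var) (y : dual_var) : \bar R :=
  (lifted_obj eps lambda1 lambda2 lambda3 v
   - (\sum_(t < T) inner_mx (dW y t)
        (lU v t - sqrt_mx (X t *m (X t)^T) *m lTheta v t))%:E
   - (\sum_(t < T) inner_mx (dY y t)
        (offdiag (lTheta v t) - lUpsilon v t))%:E
   - (\sum_(t < T.-1) inner_mx (dZ y t)
        (diff_time (lTheta v) t - lD v t))%:E)%E.

Definition dual_function (X : 'I_T -> 'cV[R]_p)
    (eps lambda1 lambda2 lambda3 : R) (y : dual_var) : \bar R :=
  ereal_inf [set lagrangian X eps lambda1 lambda2 lambda3 v y
            | v in [set v | lifted_dom v]].

Definition dual_obj (X : 'I_T -> 'cV[R]_p) (eps lambda2 lambda3 : R)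
    (y : dual_var) : R :=
  \sum_(t < T) (- (2^-1) * \tr ((dW y t)^T *m dW y t))
  + eps * \sum_(t < T) \tr (zdiff (dZ y) t - 1%:M
                            + sqrt_mx (X t *m (X t)^T) *m dW y t - dY y t)
  + \sum_(t < T.-1) calG T lambda2 lambda3 (frobenius (dZ y t)).

Definition dual_slack (X : 'I_T -> 'cV[R]_p) (y : dual_var) (t : 'I_T) :
    'M[R]_p :=
  zdiff (dZ y) t - 1%:M + Sym_part (sqrt_mx (X t *m (X t)^T) *m dW y t)
  - dY y t.

Definition dual_constraints (X : 'I_T -> 'cV[R]_p) (lambda1 : R)
    (y : dual_var) : Prop :=
  (forall t, loewner_ge (dual_slack X y t) 0) /\
  (forall t u v, u != v -> `|dY y t u v| <= lambda1 * T%:R).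

Definition dual_strict_constraints (X : 'I_T -> 'cV[R]_p) (lambda1 : R)
    (y : dual_var) : Prop :=
  (forall t, loewner_gt (dual_slack X y t) 0) /\
  (forall t u v, u != v -> `|dY y t u v| < lambda1 * T%:R).

Definition dual_feasible (X : 'I_T -> 'cV[R]_p) (lambda1 : R)
    (y : dual_var) : Prop :=
  dual_dom y /\ dual_constraints X lambda1 y.

Definition dual_slater (X : 'I_T -> 'cV[R]_p) (lambda1 : R)
    (y : dual_var) : Prop :=
  dual_feasible X lambda1 y /\ dual_strict_constraints X lambda1 y.

Definition dual_value (X : 'I_T -> 'cV[R]_p)
    (eps lambda1 lambda2 lambda3 : R) : \bar R :=
  ereal_sup [set (dual_obj X eps lambda2 lambda3 y)%:E
            | y in [set y | dual_feasible X lambda1 y]].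

End Problems.

Arguments lifted_var : clear implicits.
Arguments dual_var : clear implicits.

(* Main.v *)
(** The minimum of the Lagrangian splits into independent minimisations over
    [U_t], [Theta_t], [Upsilon_t] and [D_t], each with an explicit minimiser
    ([U = W], [Theta = eps I], [Upsilon = 0], [D] a multiple of [Z]); a violated
    dual constraint gives a ray along which the Lagrangian tends to -oo.

    For the absence of a duality gap, perturb the equality constraints of the
    lifted problem by an arbitrary residual.  The perturbed optimal value is a
    convex function, finite for every residual because [Theta = eps I] can always
    be completed, so it has a subgradient at 0 (Hahn-Banach in finite dimension):
    a multiplier whose dual value is the primal value.

    If the [X_t X_t^T] sum to a positive definite matrix, [W_t] a large multiple
    of [(X_t X_t^T)^{1/2}], with [Z] averaging the resulting terms over time, makes
    every dual slack at least [I].  Weak duality at this point then bounds the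
    traces on primal sublevel sets, so a minimiser exists by compactness. *)
Require Import Defs.
From HB Require Import structures.
From mathcomp Require Import all_boot all_order all_algebra.
From mathcomp Require Import all_classical all_reals all_analysis.
From mathcomp Require Import ring lra.

Set Implicit Arguments.
Unset Strict Implicit.
Unset Printing Implicit Defensive.

Import Order.TTheory GRing.Theory Num.Theory.
Import numFieldNormedType.Exports.

Local Open Scope classical_set_scope.
Local Open Scope ring_scope.

(** * Quadratic forms and the Frobenius inner product *)

Section Matrices.
Context {R : realType} {p : nat}.
Implicit Types (A B C : 'M[R]_p) (x y : 'cV[R]_p) (a b c : R).

Lemma inner_mxE A B : inner_mx A B = \sum_i \sum_j A i j * B i j.
Proof.
rewrite /inner_mx /mxtrace exchange_big /=; apply: eq_bigr => j _.
by rewrite mxE; apply: eq_bigr => i _; rewrite mxE.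
Qed.

Lemma inner_mxC A B : inner_mx A B = inner_mx B A.
Proof.
by rewrite !inner_mxE; apply: eq_bigr => i _; apply: eq_bigr => j _; rewrite mulrC.
Qed.

Lemma inner_mxDr A B C : inner_mx A (B + C) = inner_mx A B + inner_mx A C.
Proof. by rewrite /inner_mx mulmxDr mxtraceD. Qed.

Lemma inner_mxZr A a B : inner_mx A (a *: B) = a * inner_mx A B.
Proof. by rewrite /inner_mx -scalemxAr mxtraceZ. Qed.

Lemma inner_mxNr A B : inner_mx A (- B) = - inner_mx A B.
Proof. by rewrite -scaleN1r inner_mxZr mulN1r. Qed.

Lemma inner_mxBr A B C : inner_mx A (B - C) = inner_mx A B - inner_mx A C.
Proof. by rewrite inner_mxDr inner_mxNr. Qed.

Lemma inner_mxDl A B C : inner_mx (A + B) C = inner_mx A C + inner_mx B C.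
Proof. by rewrite !(inner_mxC _ C) inner_mxDr. Qed.

Lemma inner_mxZl A a B : inner_mx (a *: A) B = a * inner_mx A B.
Proof. by rewrite !(inner_mxC _ B) inner_mxZr. Qed.

Lemma inner_mxNl A B : inner_mx (- A) B = - inner_mx A B.
Proof. by rewrite !(inner_mxC _ B) inner_mxNr. Qed.

Lemma inner_mxBl A B C : inner_mx (A - B) C = inner_mx A C - inner_mx B C.
Proof. by rewrite inner_mxDl inner_mxNl. Qed.

Lemma inner_mx0r A : inner_mx A 0 = 0.
Proof. by rewrite /inner_mx mulmx0 mxtrace0. Qed.

Lemma inner_mx0l A : inner_mx 0 A = 0.
Proof. by rewrite inner_mxC inner_mx0r. Qed.

Lemma inner_mx_scalar A a : inner_mx A a%:M = a * \tr A.
Proof. by rewrite /inner_mx mul_mx_scalar mxtraceZ mxtrace_tr. Qed.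

Lemma inner_mx_trmx A B : inner_mx A^T B^T = inner_mx A B.
Proof. by rewrite /inner_mx -trmx_mul mxtrace_tr mxtrace_mulC. Qed.

Lemma inner_mx_suml (I : Type) (r : seq I) (F : I -> 'M[R]_p) B :
  inner_mx (\sum_(i <- r) F i) B = \sum_(i <- r) inner_mx (F i) B.
Proof.
by elim/big_rec2: _ => [|i u v _ IH]; rewrite ?inner_mx0l // inner_mxDl IH.
Qed.

Lemma inner_mx_ge0 A : 0 <= inner_mx A A.
Proof.
by rewrite inner_mxE; apply: sumr_ge0 => i _; apply: sumr_ge0 => j _; rewrite -expr2 sqr_ge0.
Qed.

Lemma frobenius_ge0 A : 0 <= frobenius A. Proof. exact: sqrtr_ge0. Qed.

Lemma frobenius_sqr A : frobenius A ^+ 2 = inner_mx A A.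
Proof.
have -> : frobenius A = Num.sqrt (inner_mx A A) by rewrite inner_mxE.
by rewrite sqr_sqrtr // inner_mx_ge0.
Qed.

Lemma frobenius_eq0 A : frobenius A = 0 -> A = 0.
Proof.
move=> A0; apply/matrixP => i j; rewrite mxE.
have : inner_mx A A == 0 by rewrite -frobenius_sqr A0 expr0n.
rewrite inner_mxE psumr_eq0 => [/allP/(_ i (mem_index_enum _))|k _]; last first.
  by apply: sumr_ge0 => l _; rewrite -expr2 sqr_ge0.
rewrite /= psumr_eq0 => [/allP/(_ j (mem_index_enum _))|l _]; last first.
  by rewrite -expr2 sqr_ge0.
by rewrite /= -expr2 sqrf_eq0 => /eqP.
Qed.

Lemma frobenius0 : frobenius (0 : 'M[R]_p) = 0.
Proof.
by apply/eqP; rewrite -sqrf_eq0 frobenius_sqr inner_mx0r.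
Qed.

Lemma frobeniusZ a A : frobenius (a *: A) = `|a| * frobenius A.
Proof.
apply: (@pexpIrn _ 2) => //; rewrite ?nnegrE ?mulr_ge0 ?frobenius_ge0 //.
by rewrite exprMn !frobenius_sqr inner_mxZl inner_mxZr real_normK ?num_real // mulrA expr2.
Qed.

Lemma frobeniusN A : frobenius (- A) = frobenius A.
Proof. by rewrite -scaleN1r frobeniusZ normrN1 mul1r. Qed.

(** Expand the nonnegative square of [frobenius B *: A - frobenius A *: B] and divide by the product
    of the norms. A zero norm forces a zero matrix and is treated apart. *)
Lemma frobenius_cauchy A B : inner_mx A B <= frobenius A * frobenius B.
Proof.
have := frobenius_ge0 A; rewrite le_eqVlt => /predU1P[A0|A0].
  by rewrite (frobenius_eq0 (esym A0)) inner_mx0l frobenius0 mul0r.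
have := frobenius_ge0 B; rewrite le_eqVlt => /predU1P[B0|B0].
  by rewrite (frobenius_eq0 (esym B0)) inner_mx0r frobenius0 mulr0.
have := inner_mx_ge0 (frobenius B *: A - frobenius A *: B).
rewrite inner_mxBr !inner_mxBl !inner_mxZl !inner_mxZr -!frobenius_sqr (inner_mxC B).
set a := frobenius A in A0 *; set b := frobenius B in B0 *; set s := inner_mx A B => h.
rewrite -(ler_pM2l (mulr_gt0 A0 B0)); lra.
Qed.

Lemma frobenius_triangle A B : frobenius (A + B) <= frobenius A + frobenius B.
Proof.
rewrite -(@ler_pXn2r _ 2) ?nnegrE ?addr_ge0 ?frobenius_ge0 //.
rewrite frobenius_sqr inner_mxDr !inner_mxDl sqrrD -!frobenius_sqr (inner_mxC B).
have := frobenius_cauchy A B; lra.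
Qed.

(** Ties positive semi-definiteness to [inner_mx]; it later turns a violated slack into a rank-one
    direction for [Theta]. *)
Lemma quadE A x : (x^T *m A *m x) 0 0 = inner_mx (x *m x^T) A.
Proof.
by rewrite /inner_mx trmx_mul trmxK -[in RHS]mulmxA mxtrace_mulC /mxtrace big_ord1.
Qed.

Definition bilin A x y : R := (x^T *m A *m y) 0 0.

Lemma bilinDl A x y z : bilin A (x + y) z = bilin A x z + bilin A y z.
Proof. by rewrite /bilin linearD /= !mulmxDl mxE. Qed.

Lemma bilinDr A x y z : bilin A z (x + y) = bilin A z x + bilin A z y.
Proof. by rewrite /bilin !mulmxDr mxE. Qed.

Lemma bilinZl A a x y : bilin A (a *: x) y = a * bilin A x y.
Proof. by rewrite /bilin linearZ /= -!scalemxAl mxE. Qed.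

Lemma bilinZr A a x y : bilin A x (a *: y) = a * bilin A x y.
Proof. by rewrite /bilin -!scalemxAr mxE. Qed.

Lemma bilin_mxD A B x y : bilin (A + B) x y = bilin A x y + bilin B x y.
Proof. by rewrite /bilin mulmxDr mulmxDl mxE. Qed.

Lemma bilin_mxZ a A x y : bilin (a *: A) x y = a * bilin A x y.
Proof. by rewrite /bilin -scalemxAr -scalemxAl mxE. Qed.

Lemma bilin_mxB A B x y : bilin (A - B) x y = bilin A x y - bilin B x y.
Proof. by rewrite bilin_mxD -scaleN1r bilin_mxZ mulN1r. Qed.

Lemma bilin_scalar a x : bilin a%:M x x = a * (x^T *m x) 0 0.
Proof. by rewrite /bilin mul_mx_scalar -scalemxAl mxE. Qed.

Lemma bilin_sym A x y : symmetric_mx A -> bilin A x y = bilin A y x.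
Proof.
move=> As; have -> : bilin A x y = ((x^T *m A *m y)^T) 0 0 by rewrite mxE.
by rewrite !trmx_mul trmxK As mulmxA.
Qed.

Lemma bilin_delta A i j : bilin A (delta_mx i 0) (delta_mx j 0) = A i j.
Proof.
by rewrite /bilin trmx_delta -rowE -colE !mxE.
Qed.

Lemma bilinDZ A a x y : symmetric_mx A ->
  bilin A (x + a *: y) (x + a *: y) =
  bilin A x x + 2 * a * bilin A y x + a ^+ 2 * bilin A y y.
Proof.
move=> As; rewrite bilinDr !bilinDl !bilinZr !bilinZl (bilin_sym x y As); ring.
Qed.

(** * The positive semi-definite order *)

Lemma loewner_ge0P A :
  loewner_ge A 0 <-> symmetric_mx A /\ forall x, 0 <= bilin A x x.
Proof.
split=> [[As _ Ap]|[As Ap]]; split=> //; rewrite ?/symmetric_mx ?trmx0 //.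
  by move=> x; have := Ap x; rewrite subr0.
by move=> x; rewrite subr0; apply: Ap.
Qed.

Lemma symmetric_scalar a : symmetric_mx (a%:M : 'M[R]_p).
Proof. exact: tr_scalar_mx. Qed.

Lemma symmetricD A B : symmetric_mx A -> symmetric_mx B -> symmetric_mx (A + B).
Proof. by move=> hA hB; rewrite /symmetric_mx linearD /= hA hB. Qed.

Lemma symmetricN A : symmetric_mx A -> symmetric_mx (- A).
Proof. by move=> hA; rewrite /symmetric_mx linearN /= hA. Qed.

Lemma symmetricZ a A : symmetric_mx A -> symmetric_mx (a *: A).
Proof. by move=> hA; rewrite /symmetric_mx linearZ /= hA. Qed.

Lemma symmetric0 : symmetric_mx (0 : 'M[R]_p).
Proof. exact: trmx0. Qed.

Lemma symmetric_sum (I : Type) (r : seq I) (F : I -> 'M[R]_p) :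
  (forall i, symmetric_mx (F i)) -> symmetric_mx (\sum_(i <- r) F i).
Proof. by move=> h; apply: big_ind => //; [exact: symmetric0|exact: symmetricD]. Qed.

Lemma symmetric_outer x : symmetric_mx (x *m x^T).
Proof. by rewrite /symmetric_mx trmx_mul trmxK. Qed.

Lemma bilin_outer x y : bilin (x *m x^T) y y = (x^T *m y) 0 0 ^+ 2.
Proof.
rewrite /bilin mulmxA -mulmxA mxE big_ord1 expr2; congr (_ * _).
by rewrite !mxE; apply: eq_bigr => i _; rewrite !mxE mulrC.
Qed.

Lemma loewner_ge_sub A B : loewner_ge A B <->
  [/\ symmetric_mx A, symmetric_mx B & loewner_ge (A - B) 0].
Proof.
split=> [[As Bs h]|[As Bs [_ _ h]]]; split=> //.
  split; [exact: symmetricD (symmetricN Bs)|exact: symmetric0|].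
  by move=> x; rewrite subr0.
by move=> x; have := h x; rewrite subr0.
Qed.

Lemma loewner_geD A B : loewner_ge A 0 -> loewner_ge B 0 -> loewner_ge (A + B) 0.
Proof.
move=> /loewner_ge0P[As Ap] /loewner_ge0P[Bs Bp]; apply/loewner_ge0P.
split; first exact: symmetricD.
by move=> x; rewrite bilin_mxD addr_ge0.
Qed.

Lemma loewner_geZ a A : 0 <= a -> loewner_ge A 0 -> loewner_ge (a *: A) 0.
Proof.
move=> a0 /loewner_ge0P[As Ap]; apply/loewner_ge0P; split; first exact: symmetricZ.
by move=> x; rewrite bilin_mxZ mulr_ge0.
Qed.

Lemma outer_ge0 x : loewner_ge (x *m x^T) 0.
Proof.
apply/loewner_ge0P; split; first exact: symmetric_outer.
by move=> y; rewrite bilin_outer sqr_ge0.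
Qed.

Lemma norm_sqr_ge0 x : 0 <= (x^T *m x) 0 0.
Proof. by rewrite mxE sumr_ge0 // => i _; rewrite mxE -expr2 sqr_ge0. Qed.

Lemma norm_sqr_gt0 x : x != 0 -> 0 < (x^T *m x) 0 0.
Proof.
move=> x0; rewrite lt_neqAle norm_sqr_ge0 andbT eq_sym; apply: contra x0.
rewrite mxE psumr_eq0 => [/allP h|i _]; last by rewrite mxE -expr2 sqr_ge0.
apply/eqP/matrixP => i j; rewrite ord1 mxE.
by have := h i (mem_index_enum _); rewrite /= mxE -expr2 sqrf_eq0 => /eqP.
Qed.

Lemma psd_scalar a : 0 <= a -> loewner_ge (a%:M : 'M[R]_p) 0.
Proof.
move=> a0; apply/loewner_ge0P; split; first exact: symmetric_scalar.
by move=> x; rewrite bilin_scalar mulr_ge0 // norm_sqr_ge0.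
Qed.

(* Gaussian elimination: a positive diagonal entry is cleared by subtracting a
   rank-one term, and the row of a zero diagonal entry vanishes. *)
Lemma psd_sum_outer A : loewner_ge A 0 ->
  exists s : seq 'cV[R]_p, A = \sum_(v <- s) v *m v^T.
Proof.
move=> /loewner_ge0P[].
(* Induction on a bound [n] from which on all rows, hence by symmetry all columns, vanish. *)
have [n] : exists n, forall i j : 'I_p, (n <= i)%N -> A i j = 0.
  by exists p => i j; rewrite leqNgt ltn_ord.
elim: n A => [|n IH] A A0 As Ap.
  by exists [::]; rewrite big_nil; apply/matrixP => i j; rewrite A0 // mxE.
have [np|np] := ltnP n p; last first.
  by apply: IH => // i j ni; have := leq_trans (ltn_ord i) np; rewrite ltnNge ni.
pose k := Ordinal np; have AE i j : A i j = A j i by rewrite -{1}As mxE.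
have d0 : 0 <= A k k by rewrite -bilin_delta.
move: d0; rewrite le_eqVlt => /predU1P[d0|d0].
  have Ak j : A k j = 0.
    apply/eqP/negPn/negP => Akj.
    (* With [A k k = 0] the form is affine along the [k]-th axis; this coefficient brings its value
       to [-1]. *)
    have := Ap (delta_mx j 0 + (- (A j j + 1) / (2 * A k j)) *: delta_mx k 0).
    rewrite bilinDZ // !bilin_delta -d0 mulr0 addr0.
    have -> : 2 * (- (A j j + 1) / (2 * A k j)) * A k j = - (A j j + 1).
      by field; rewrite Akj.
    lra.
  apply: IH => // i j; rewrite leq_eqVlt => /predU1P[ni|/A0 ->//].
  by rewrite (_ : i = k) //; apply: val_inj.
pose B := A - (A k k)^-1 *: (col k A *m (col k A)^T).
have BE i j : B i j = A i j - (A k k)^-1 * (A i k * A j k).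
  by rewrite !mxE big_ord1 !mxE.
have [||x|s sE] := IH B.
- move=> i j; rewrite leq_eqVlt => /predU1P[ni|ni].
    have -> : i = k by apply: val_inj.
    by rewrite BE mulKf ?gt_eqF // AE subrr.
  by rewrite BE (A0 i j) // (A0 i k) // mul0r mulr0 subrr.
- by apply/matrixP => i j; rewrite mxE !BE AE [A i k * _]mulrC.
(* Completing the square: the form of [B] at [x] is the form of [A] at the minimiser over the line
   through [x] along the [k]-th axis. *)
- pose m := bilin A (delta_mx k 0) x.
  have -> : bilin B x x = bilin A (x + (- (m / A k k)) *: delta_mx k 0)
                                  (x + (- (m / A k k)) *: delta_mx k 0).
    rewrite bilinDZ // bilin_delta -/m.
    have -> : bilin B x x = bilin A x x - (A k k)^-1 * m ^+ 2.
      rewrite bilin_mxB bilin_mxZ bilin_outer; congr (_ - _ * _ ^+ 2).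
      by rewrite /m /bilin trmx_delta -rowE tr_col As.
    by field; rewrite gt_eqF.
  exact: Ap.
exists (Num.sqrt (A k k)^-1 *: col k A :: s).
rewrite big_cons -sE linearZ /= -scalemxAl -scalemxAr scalerA -expr2 sqr_sqrtr ?invr_ge0 ?ltW //.
by rewrite /B addrC subrK.
Qed.

(** Each rank-one summand of [A] pairs with [B] to a value of the quadratic form of [B]. *)
Lemma inner_psd_ge0 A B : loewner_ge A 0 -> loewner_ge B 0 -> 0 <= inner_mx A B.
Proof.
move=> /psd_sum_outer[s ->] /loewner_ge0P[_ Bp].
by rewrite inner_mx_suml; apply: sumr_ge0 => v _; rewrite -quadE; apply: Bp.
Qed.

(** Testing the form at [e_i + e_j] and [e_i - e_j] bounds [2 |A i j|] by [A i i + A j j]. This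
    converts trace bounds into the entrywise bounds needed for compactness. *)
Lemma psd_entry_le_tr A i j : loewner_ge A 0 -> `|A i j| <= \tr A.
Proof.
move=> /loewner_ge0P[As Ap].
have Aii k : 0 <= A k k by rewrite -bilin_delta.
have [->|ij] := eqVneq i j.
  by rewrite ger0_norm // /mxtrace (bigD1 j) //= lerDl sumr_ge0.
have : A i i + A j j <= \tr A.
  rewrite /mxtrace (bigD1 i) //= (bigD1 j) 1?eq_sym //= addrA lerDl.
  by apply: sumr_ge0.
have := Ap (delta_mx i 0 + 1 *: delta_mx j 0).
have := Ap (delta_mx i 0 + (-1) *: delta_mx j 0).
have := Aii i; have := Aii j.
rewrite !bilinDZ // !bilin_delta (_ : A j i = A i j); last by rewrite -{1}As mxE.
by move=> *; rewrite ler_norml; apply/andP; split; lra.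
Qed.

(* The root of [x *m x^T] is [x *m x^T / |x|]. *)
Lemma sqrt_outerP x : loewner_ge (sqrt_mx (x *m x^T)) 0 /\
  sqrt_mx (x *m x^T) *m sqrt_mx (x *m x^T) = x *m x^T.
Proof.
apply: (@xgetPex _ 0 [set B : 'M[R]_p | loewner_ge B 0 /\ B *m B = x *m x^T]).
have [->|x0] := eqVneq x 0.
  exists 0 => /=; rewrite !mul0mx; split=> //.
  by have := psd_scalar (lexx 0); rewrite raddf0.
exists ((Num.sqrt ((x^T *m x) 0 0))^-1 *: (x *m x^T)); split.
  by apply: loewner_geZ (outer_ge0 _); rewrite invr_ge0 sqrtr_ge0.
have := norm_sqr_gt0 x0; have := mx11_scalar (x^T *m x).
move: (_ 0 0) => n nE n0.
rewrite -scalemxAl -scalemxAr scalerA mulmxA -(mulmxA x) nE.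
rewrite mul_mx_scalar -scalemxAl scalerA -expr2 exprVn sqr_sqrtr ?ltW //.
by rewrite mulVf ?scale1r ?gt_eqF.
Qed.

(** Cauchy-Schwarz against [x *m x^T], whose Frobenius norm is the squared norm of [x]. Adding 1
    keeps the constant positive when [A] is zero. *)
Lemma bilin_le_norm_sqr A :
  exists2 K, 0 < K & forall x, bilin A x x <= K * (x^T *m x) 0 0.
Proof.
exists (frobenius A + 1); first by have := frobenius_ge0 A; lra.
move=> x; rewrite /bilin quadE.
have hn : frobenius (x *m x^T) = (x^T *m x) 0 0.
  apply: (@pexpIrn _ 2) => //; rewrite ?nnegrE ?frobenius_ge0 ?norm_sqr_ge0 //.
  by rewrite frobenius_sqr -quadE -[LHS]/(bilin _ _ _) bilin_outer.
have := frobenius_cauchy (x *m x^T) A; rewrite hn; have := norm_sqr_ge0 x; lra.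
Qed.

(* With [K] an upper bound for the form of [A^-1], expand the nonnegative form
   of [A] at [A^-1 x - K x]. *)
Lemma pd_ge_scalar A : loewner_gt A 0 ->
  exists2 c, 0 < c & loewner_ge (A - c%:M) 0.
Proof.
move=> [As _ Ap'].
have Ap x : x != 0 -> 0 < bilin A x x by move=> /Ap'; rewrite subr0.
have Ap0 x : 0 <= bilin A x x.
  have [->|/Ap/ltW//] := eqVneq x 0; by rewrite /bilin mulmx0 mxE.
have Au : A \in unitmx.
  rewrite -row_free_unit -kermx_eq0; apply/negPn/negP => /rowV0Pn[u /sub_kermxP uA u0].
  have : u^T != 0 by rewrite -(inj_eq trmx_inj) trmxK trmx0.
  by move/Ap; rewrite /bilin trmxK uA mul0mx mxE ltxx.
have [K K0 hK] := bilin_le_norm_sqr (invmx A).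
exists K^-1; first by rewrite invr_gt0.
apply/loewner_ge0P; split; first exact: symmetricD (symmetricN (symmetric_scalar _)).
move=> x; have := Ap0 (invmx A *m x + (- K) *: x); rewrite bilinDZ //.
have -> : bilin A x (invmx A *m x) = (x^T *m x) 0 0.
  by rewrite /bilin mulmxA mulmxK.
have -> : bilin A (invmx A *m x) (invmx A *m x) = bilin (invmx A) x x.
  by rewrite /bilin mulmxA mulmxK // trmx_mul trmx_inv As.
rewrite bilin_mxB bilin_scalar; have := hK x.
move: (bilin (invmx A) x x) (bilin A x x) ((x^T *m x) 0 0) => u v w h1 h2.
rewrite -(pmulr_rge0 _ (exprn_gt0 2 K0)).
have -> : K ^+ 2 * (v - K^-1 * w) = K ^+ 2 * v - K * w by field; rewrite gt_eqF.
lra.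
Qed.

End Matrices.

(** * The scalar penalty and its conjugate *)

Section ScalarPenalty.
Context {R : realType}.
Implicit Types x y z a b c l r : R.

Lemma posp_ge0 x : 0 <= posp x.
Proof. by rewrite /posp le_max lexx orbT. Qed.

Lemma posp_ge x : x <= posp x.
Proof. by rewrite /posp le_max lexx. Qed.

Lemma posp_le x y : posp x <= y <-> x <= y /\ 0 <= y.
Proof. by rewrite /posp ge_max; split=> [/andP|[-> ->]]. Qed.

Lemma pospE x : posp x = if x <= 0 then 0 else x.
Proof. by rewrite /posp maxElt; case: ltrgtP. Qed.

(** With [q] the excess of [|x|] over [l], the penalty is [|x| + q^2 + (2 l - 1) q]. As [l] is at
    least one half, every summand is convex and nondecreasing in [|x|], and no case split
    remains. *)
Lemma calRE l x : 2^-1 <= l ->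
  calR l x = `|x| + (posp (`|x| - l) ^+ 2 + (2 * l - 1) * posp (`|x| - l)).
Proof.
move=> l2; rewrite /calR pospE subr_le0; case: ifP => _; first ring.
by rewrite -(real_normK (num_real x)); ring.
Qed.

(** Convexity and monotonicity in one statement: the norm of a convex combination is only bounded
    by, not equal to, the combination of the norms. *)
Lemma calR_convex l a b x y z : 2^-1 <= l -> 0 <= a -> 0 <= b -> a + b = 1 ->
  0 <= x -> 0 <= y -> 0 <= z -> x <= a * y + b * z ->
  calR l x <= a * calR l y + b * calR l z.
Proof.
move=> l2 a0 b0 ab x0 y0 z0 xyz; rewrite !calRE // !ger0_norm //.
set u := posp (y - l); set v := posp (z - l).
have [u0 v0] : 0 <= u /\ 0 <= v by rewrite !posp_ge0.
have [u1 v1] : y - l <= u /\ z - l <= v by rewrite !posp_ge.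
have uv0 : 0 <= a * u + b * v by rewrite addr_ge0 ?mulr_ge0.
have w1 : posp (x - l) <= a * u + b * v.
  apply/posp_le; split=> //; have bE : b = 1 - a by lra.
  have := ler_wpM2l a0 u1; have := ler_wpM2l b0 v1; rewrite bE in xyz *; lra.
have w2 : posp (x - l) ^+ 2 <= a * u ^+ 2 + b * v ^+ 2.
  apply: (@le_trans _ _ ((a * u + b * v) ^+ 2)).
    by rewrite ler_pXn2r ?nnegrE ?posp_ge0.
  have -> : a * u ^+ 2 + b * v ^+ 2 = (a * u + b * v) ^+ 2 + a * b * (u - v) ^+ 2.
    by rewrite (_ : b = 1 - a); [ring|lra].
  by rewrite lerDl mulr_ge0 ?sqr_ge0 ?mulr_ge0.
have l0 : 0 <= 2 * l - 1 by lra.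
have := ler_wpM2l l0 w1; lra.
Qed.

(** Only [c = l2 * T] matters, and [x / (2 * c)] is the vertex of the parabola [c r^2 - x r]. *)
Lemma calGE (T : nat) l2 l x : 0 < l2 -> (0 < T)%N ->
  let c := l2 * T%:R in
  calG T l2 l x = Num.min (- posp (x - c) * l)
    (c * (posp (l - x / (2 * c)) ^+ 2 - (x / (2 * c)) ^+ 2 - l ^+ 2 + l)).
Proof.
move=> l20 T0 c; rewrite /calG -/c -[2 * l2 * _]mulrA -/c.
suff -> : x ^+ 2 / (4 * l2 ^+ 2 * T%:R ^+ 2) = (x / (2 * c)) ^+ 2 by [].
have T0' : T%:R != 0 :> R by rewrite pnatr_eq0 -lt0n.
by rewrite /c; field; rewrite T0' gt_eqF.
Qed.

(* [calG] is the concave conjugate of [c * calR l]: its two arguments are the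
   minima of [c * calR l r - x * r] over [0 <= r <= l] and over [l <= r]. *)
Lemma calG_le (T : nat) l2 l x r : 0 < l2 -> (0 < T)%N -> 2^-1 <= l ->
  0 <= x -> 0 <= r -> calG T l2 l x <= l2 * T%:R * calR l r - x * r.
Proof.
move=> l20 T0 hl x0 r0; rewrite calGE //= ge_min; set c := l2 * T%:R.
have c0 : 0 < c by rewrite mulr_gt0 ?ltr0n.
rewrite /calR ger0_norm //; case: ifP => [rl|/negbT]; last rewrite -ltNge => lr.
  apply/orP; left; have := posp_ge (x - c); have := posp_ge0 (x - c).
  move: (posp _) => q q0 /(ler_wpM2r r0); have := ler_wpM2l q0 rl; lra.
apply/orP; right; set y := x / (2 * c); have xE : x = 2 * c * y.
  by rewrite /y; field; rewrite gt_eqF.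
rewrite xE.
have -> : c * (r ^+ 2 - l ^+ 2 + l) - 2 * c * y * r =
          c * ((r - y) ^+ 2 - y ^+ 2 - l ^+ 2 + l) by ring.
rewrite ler_pM2l // !lerD2r pospE; case: ifP => [_|/negbT].
  by rewrite expr0n sqr_ge0.
by rewrite -ltNge => ly; rewrite ler_pXn2r ?nnegrE //; lra.
Qed.

(** On [[0, l]] the function is linear, so an endpoint is optimal; beyond [l] the optimum is the
    vertex [y], or [l] when the vertex lies below it. *)
Lemma calG_attained (T : nat) l2 l x : 0 < l2 -> (0 < T)%N -> 2^-1 <= l ->
  0 <= x -> exists2 r, 0 <= r & calG T l2 l x = l2 * T%:R * calR l r - x * r.
Proof.
move=> l20 T0 hl x0; rewrite calGE //=; set c := l2 * T%:R.
have c0 : 0 < c by rewrite mulr_gt0 ?ltr0n.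
have calR_ge r : l <= r -> calR l r = r ^+ 2 - l ^+ 2 + l.
  move=> lr; rewrite /calR ger0_norm; last lra.
  by case: ifP => // rl; rewrite (_ : r = l); [ring|lra].
rewrite minElt; case: ifP => _.
  rewrite pospE; case: ifP => _.
    by exists 0 => //; rewrite /calR normr0 (_ : 0 <= l); [ring|lra].
  exists l; first lra.
  by rewrite calR_ge //; ring.
set y := x / (2 * c); have xE : x = 2 * c * y.
  by rewrite /y; field; rewrite gt_eqF.
rewrite xE pospE; case: ifP => [ly|_].
  by exists y; [lra|rewrite calR_ge; [ring|lra]].
by exists l; [lra|rewrite calR_ge //; ring].
Qed.

End ScalarPenalty.

(* Hahn-Banach for a convex set of pairs (u, r) instead of a convex function,
   so that no infimum over r has to be formed; the functional is extended one
   coordinate at a time. *)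
Lemma convex_support (R : realType) (I : finType) (C : (I -> R) -> R -> Prop) :
  (forall u v r q a b, C u r -> C v q -> 0 < a -> 0 < b -> a + b = 1 ->
     C (fun i => a * u i + b * v i) (a * r + b * q)) ->
  (forall u, exists r, C u r) ->
  (forall r, C (fun=> 0) r -> 0 <= r) ->
  exists c : I -> R, forall u r, C u r -> \sum_i c i * u i <= r.
Proof.
move=> Cconv Ctot C0.
(* Restricting [u] to vectors supported on a list of coordinates lets the list grow by induction. *)
suff [c hc] : exists c : I -> R, forall u r, C u r ->
    (forall i, i \notin enum I -> u i = 0) -> \sum_i c i * u i <= r.
  by exists c => u r /hc; apply=> i; rewrite mem_enum.
elim: (enum I) => [|k s [c IH]].
  exists (fun=> 0) => u r Cur u0; rewrite big1 => [|i _]; last by rewrite mul0r.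
  by apply: C0; congr C : Cur; apply: funext => i; rewrite u0.
pose l (u : I -> R) := \sum_(i | i != k) c i * u i.
have IHl u r : C u r -> (forall i, i \notin k :: s -> u i = 0) -> u k = 0 -> l u <= r.
  move=> Cur us uk; have := IH u r Cur; rewrite (bigD1 k) //= uk mulr0 add0r; apply.
  by move=> i /negbTE si; have [->//|ik] := eqVneq i k; apply: us; rewrite in_cons (negbTE ik) si.
pose on (u : I -> R) := forall i, i \notin k :: s -> u i = 0.
(* [L] and [U] hold the lower and upper bounds imposed on the coefficient of [k] by points with
   negative and positive [k]-th coordinate. *)
pose L := [set a : R | exists u r, [/\ C u r, on u, u k < 0 & a = (l u - r) / (- u k)]].
pose U := [set a : R | exists u r, [/\ C u r, on u, 0 < u k & a = (r - l u) / u k]].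
have LU a b : L a -> U b -> a <= b.
  move=> [u [r [Cur ou uk ->]]] [v [q [Cvq ov vk ->]]].
  have w0 : 0 < v k - u k by lra.
  (* These weights cancel the [k]-th coordinate, so the induction hypothesis applies to the
     combination. *)
  have := Cconv _ _ _ _ (v k / (v k - u k)) (- u k / (v k - u k)) Cur Cvq.
  move=> /(_ _ _ _)/IHl h.
  rewrite ler_pdivrMr ?oppr_gt0 // mulrAC ler_pdivlMr //.
  have : l (fun i => v k / (v k - u k) * u i + - u k / (v k - u k) * v i) <=
         v k / (v k - u k) * r + - u k / (v k - u k) * q.
    apply: h.
    - by rewrite divr_gt0.
    - by rewrite divr_gt0 // oppr_gt0.
    - by field; rewrite gt_eqF.
    - by move=> i si /=; rewrite (ou i si) (ov i si) !mulr0 addr0.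
    - by field; rewrite gt_eqF.
  have -> : l (fun i => v k / (v k - u k) * u i + - u k / (v k - u k) * v i) =
     v k / (v k - u k) * l u + - u k / (v k - u k) * l v.
    by rewrite /l !mulr_sumr -big_split; apply: eq_bigr => i _ /=; ring.
  move: (l u) (l v) => lu lv; rewrite -(ler_pM2l w0).
  have e x y : (v k - u k) * (v k / (v k - u k) * x + - u k / (v k - u k) * y) =
      v k * x - u k * y by field; rewrite gt_eqF.
  by rewrite !e => ?; lra.
have one a : on (fun i => if i == k then a else 0).
  by move=> i; rewrite in_cons negb_or => /andP[/negbTE -> _].
(* Totality of [C] at plus and minus the [k]-th unit vector makes [U] and [L] nonempty, so [sup L]
   is a genuine supremum. *)
have [r1 Cr1] := Ctot (fun i => if i == k then 1 else 0).
have [r2 Cr2] := Ctot (fun i => if i == k then - 1 else 0).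
have U0 : U ((r1 - l (fun i => if i == k then 1 else 0)) / 1).
  by exists (fun i => if i == k then 1 else 0), r1; rewrite !eqxx; split.
have L0 : L !=set0.
  by eexists; exists (fun i => if i == k then - 1 else 0), r2; rewrite eqxx ltrN10; split.
exists (fun i => if i == k then sup L else c i) => u r Cur ou.
rewrite (bigD1 k) //= eqxx (eq_bigr (fun i => c i * u i)); last first.
  by move=> i /negbTE ->.
rewrite -/(l u); have [uk|uk|uk] := ltrgtP (u k) 0.
- have : (l u - r) / (- u k) <= sup L.
    apply: ub_le_sup; last by exists u, r.
    by eexists => a La; exact: LU La U0.
  by rewrite ler_pdivrMr ?oppr_gt0 //; lra.
- have : sup L <= (r - l u) / u k.
    by apply: ge_sup => // a La; apply: LU La _; exists u, r.
  by rewrite ler_pdivlMr //; lra.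
- by rewrite uk mulr0 add0r; apply: IHl.
Qed.

(** * The dual function *)

Section OffDiagonal.
Context {R : realType} {p : nat}.
Implicit Types (A B : 'M[R]_p).

(** Symmetric matrices are orthogonal to antisymmetric ones. This explains [Sym] in the dual slack
    and later allows multipliers to be symmetrised. *)
Lemma inner_Sym_part A B : symmetric_mx B -> inner_mx (Sym_part A) B = inner_mx A B.
Proof.
move=> Bs; have AB : inner_mx A^T B = inner_mx A B by rewrite -{1}Bs inner_mx_trmx.
by rewrite /Sym_part inner_mxZl inner_mxDl AB; field.
Qed.

Lemma symmetric_Sym_part A : symmetric_mx (Sym_part A).
Proof.
by rewrite /symmetric_mx /Sym_part linearZ /= linearD /= trmxK addrC.
Qed.

Lemma inner_offdiag A B : inner_mx (offdiag A) B = inner_mx A (offdiag B).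
Proof.
rewrite !inner_mxE; apply: eq_bigr => i _; apply: eq_bigr => j _; rewrite !mxE.
by case: eqP => _; rewrite ?mul0r ?mulr0.
Qed.

Lemma offdiag_id A : sym_off_mx A -> offdiag A = A.
Proof.
by move=> [_ A0]; apply/matrixP => i j; rewrite mxE; case: eqP => // <-; rewrite A0.
Qed.

Lemma sym_off_offdiag A : symmetric_mx A -> sym_off_mx (offdiag A).
Proof.
move=> As; split; last by move=> i; rewrite mxE eqxx.
by apply/matrixP => i j; rewrite !mxE eq_sym -{2}As mxE.
Qed.

Lemma symmetric_sym_off A : sym_off_mx A -> symmetric_mx A.
Proof. by case. Qed.

Lemma sym_offZ a A : sym_off_mx A -> sym_off_mx (a *: A).
Proof.
by move=> [As A0]; split; [exact: symmetricZ|move=> i; rewrite mxE A0 mulr0].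
Qed.

Lemma sym_offD A B : sym_off_mx A -> sym_off_mx B -> sym_off_mx (A + B).
Proof.
move=> [As A0] [Bs B0]; split; first exact: symmetricD.
by move=> i; rewrite mxE A0 B0 addr0.
Qed.

Lemma sym_off0 : sym_off_mx (0 : 'M[R]_p).
Proof. by split=> [|i]; rewrite ?mxE //; exact: symmetric0. Qed.

Lemma norm1_offZ a A : norm1_off (a *: A) = `|a| * norm1_off A.
Proof.
rewrite /norm1_off mulr_sumr; apply: eq_bigr => i _; rewrite mulr_sumr.
by apply: eq_bigr => j _; rewrite mxE normrM.
Qed.

Lemma norm1_off0 : norm1_off (0 : 'M[R]_p) = 0.
Proof. by rewrite -(scale0r 0) norm1_offZ normr0 mul0r. Qed.

Lemma norm1_off_triangle A B : norm1_off (A + B) <= norm1_off A + norm1_off B.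
Proof.
rewrite /norm1_off -big_split; apply: ler_sum => i _ /=.
by rewrite -big_split; apply: ler_sum => j _; rewrite mxE ler_normD.
Qed.

Lemma norm1_off_offdiag A : norm1_off (offdiag A) = norm1_off A.
Proof.
by apply: eq_bigr => i _; apply: eq_bigr => j /negbTE ij; rewrite mxE ij.
Qed.

Lemma norm1_off_delta (u v : 'I_p) : u != v -> norm1_off (delta_mx u v : 'M[R]_p) = 1.
Proof.
move=> uv; rewrite /norm1_off (bigD1 u) //= (bigD1 v) //= mxE !eqxx normr1.
rewrite !big1 ?addr0 // => [i iu|j /andP[_ jv]].
  by rewrite big1 // => j _; rewrite mxE (negbTE iu) normr0.
by rewrite mxE (negbTE jv) andbF normr0.
Qed.

Lemma inner_delta A (u v : 'I_p) : inner_mx A (delta_mx u v) = A u v.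
Proof.
rewrite inner_mxE (bigD1 u) //= (bigD1 v) //= mxE !eqxx mulr1.
rewrite !big1 ?addr0 // => [i iu|j jv].
  by rewrite big1 // => j _; rewrite mxE (negbTE iu) mulr0.
by rewrite mxE (negbTE jv) andbF mulr0.
Qed.

(** Duality of the entrywise 1-norm and maximum norm off the diagonal; it makes [Upsilon = 0]
    optimal under the bound on [Y]. *)
Lemma norm1_inner_ge0 a A B : sym_off_mx A ->
  (forall u v, u != v -> `|A u v| <= a) -> 0 <= a * norm1_off B + inner_mx A B.
Proof.
move=> Ao Aa; rewrite -(offdiag_id Ao) inner_mxE /norm1_off mulr_sumr -big_split.
apply: sumr_ge0 => i _ /=; rewrite [X in _ + X](bigID (fun j => i != j)) /=.
rewrite addrA mulr_sumr -big_split addr_ge0 //= ?sumr_ge0 // => j.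
  move=> ij; rewrite mxE (negbTE ij).
  have := ler_wpM2r (normr_ge0 (B i j)) (Aa i j ij); rewrite -normrM.
  have := ler_norm (- (A i j * B i j)); rewrite normrN; lra.
by rewrite negbK => /eqP ->; rewrite mxE eqxx mul0r.
Qed.

End OffDiagonal.

(** * Summation by parts in time *)

Section SummationByParts.
Context {R : realType} {p : nat}.

(** The boundary terms of Abel summation drop out because [zpad Z] vanishes at [0] and at [T]. *)
Lemma sum_inner_diff_time (T : nat) (Z : 'I_T.-1 -> 'M[R]_p) (Theta : 'I_T -> 'M[R]_p) :
  \sum_(t < T.-1) inner_mx (Z t) (diff_time Theta t) =
  - \sum_(t < T) inner_mx (zdiff Z t) (Theta t).
Proof.
case: T Z Theta => [|n] Z Theta; first by rewrite !big_ord0 oppr0.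
under eq_bigr do rewrite inner_mxBr.
under [in RHS]eq_bigr do rewrite /zdiff inner_mxBl.
rewrite !sumrB opprB; congr (_ - _).
  rewrite big_ord_recl inner_mx0l add0r; apply: eq_bigr => i _.
  congr (inner_mx _ (Theta _)); last exact: val_inj.
  by rewrite /zpad /= add0n (valK i).
rewrite big_ord_recr /= insubF ?ltnn // inner_mx0l addr0.
apply: eq_bigr => i _; congr (inner_mx _ (Theta _)); last exact: val_inj.
by rewrite /zpad /= (valK i).
Qed.

Lemma symmetric_zdiff (T : nat) (Z : 'I_T.-1 -> 'M[R]_p) t :
  (forall s, symmetric_mx (Z s)) -> symmetric_mx (zdiff Z t).
Proof.
move=> Zs; have zs k : symmetric_mx (zpad Z k).
  by case: k => [|k] /=; [|case: insubP => [s _ _|_] /=; [exact: Zs|]]; exact: symmetric0.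
exact: symmetricD (symmetricN _).
Qed.

End SummationByParts.

(** * Real-valued form of the Lagrangian *)

Section Lagrangian.
Context {R : realType} {p T : nat}.
Variables (X : 'I_T -> 'cV[R]_p) (eps l1 l2 l3 : R).
Implicit Types (v : lifted_var R p T) (y : dual_var R p T) (Theta : 'I_T -> 'M[R]_p).

Local Notation S t := (sqrt_mx (X t *m (X t)^T)).

(** The lifted objective without its indicator terms, so that computations at feasible points stay
    in [R]. *)
Definition lifted_real v : R :=
  \sum_(t < T) (2^-1 * inner_mx (lU v t) (lU v t) - \tr (lTheta v t))
  + l1 * T%:R * \sum_(t < T) norm1_off (lUpsilon v t)
  + l2 * T%:R * \sum_(t < T.-1) calR l3 (frobenius (lD v t)).

Definition lagrangian_real v y : R :=
  lifted_real v
  - \sum_(t < T) inner_mx (dW y t) (lU v t - S t *m lTheta v t)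
  - \sum_(t < T) inner_mx (dY y t) (offdiag (lTheta v t) - lUpsilon v t)
  - \sum_(t < T.-1) inner_mx (dZ y t) (diff_time (lTheta v) t - lD v t).

Lemma lagrangian_fin v y : primal_feasible eps (lTheta v) ->
  lagrangian X eps l1 l2 l3 v y = (lagrangian_real v y)%:E.
Proof.
move=> vf; rewrite /lagrangian /lifted_obj; under eq_bigr => t _.
  rewrite /indicator_ge (asboolT (vf t)) adde0; over.
by rewrite sumEFin -!EFinD.
Qed.

Lemma lagrangian_pinfty v y : ~ primal_feasible eps (lTheta v) ->
  lagrangian X eps l1 l2 l3 v y = +oo%E.
Proof.
move=> /existsNP[t vt]; rewrite /lagrangian /lifted_obj (bigD1 t) //=.
rewrite {1}/indicator_ge asboolF // addey // addye ?addye //.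
(* No other summand is [-oo], so the infinite one decides the sum. *)
rewrite esum_eqNy negb_exists; apply/forallP => i; rewrite negb_and; apply/orP; right.
by rewrite /indicator_ge; case: ifP.
Qed.

End Lagrangian.

(** * Evaluation of the dual function *)

Section Dual.
Context {R : realType} {p T : nat}.
Variables (X : 'I_T -> 'cV[R]_p) (eps l1 l2 l3 : R).
Hypotheses (p_gt0 : (0 < p)%N) (T_gt0 : (0 < T)%N) (eps_gt0 : 0 < eps)
  (l1_gt0 : 0 < l1) (l2_gt0 : 0 < l2) (l3_ge : 2^-1 <= l3).
Implicit Types (v : lifted_var R p T) (y : dual_var R p T) (Theta : 'I_T -> 'M[R]_p).

Local Notation S t := (sqrt_mx (X t *m (X t)^T)).
Local Notation feasible := (primal_feasible eps).
Local Notation L := (lagrangian_real X l1 l2 l3).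

Lemma symmetric_sqrt_outer t : symmetric_mx (S t).
Proof. by have [[]] := sqrt_outerP (X t). Qed.

Lemma symmetric_slack y t : dual_dom y -> symmetric_mx (dual_slack X y t).
Proof.
move=> [yY yZ]; apply: symmetricD (symmetricN (symmetric_sym_off (yY t))).
apply: symmetricD (symmetric_Sym_part _).
exact: symmetricD (symmetric_zdiff _ yZ) (symmetricN (symmetric_scalar _)).
Qed.

(** The right-hand side lists the Lagrangian terms linear in [Theta_t] after summation by parts: the
    dual slack is their coefficient. *)
Lemma inner_slack y t (A : 'M[R]_p) : dual_dom y -> symmetric_mx A ->
  inner_mx (dual_slack X y t) A =
  inner_mx (zdiff (dZ y) t) A - \tr A + inner_mx (dW y t) (S t *m A)
  - inner_mx (dY y t) (offdiag A).
Proof.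
move=> [yY _] As; rewrite /dual_slack inner_mxBl inner_mxDl inner_mxBl.
rewrite inner_Sym_part // (inner_mxC 1%:M) inner_mx_scalar mul1r.
rewrite -inner_offdiag (offdiag_id (yY t)); congr (_ + _ - _).
by rewrite /inner_mx trmx_mul symmetric_sqrt_outer mulmxA.
Qed.

(** No summand on the right couples two blocks of variables or two times, so each can be minimised
    alone. *)
Lemma lagrangian_split v y : dual_dom y -> feasible (lTheta v) ->
  L v y = \sum_(t < T) (2^-1 * inner_mx (lU v t) (lU v t) - inner_mx (dW y t) (lU v t))
  + \sum_(t < T) inner_mx (dual_slack X y t) (lTheta v t)
  + \sum_(t < T) (l1 * T%:R * norm1_off (lUpsilon v t)
                  + inner_mx (dY y t) (lUpsilon v t))
  + \sum_(t < T.-1) (l2 * T%:R * calR l3 (frobenius (lD v t))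
                  + inner_mx (dZ y t) (lD v t)).
Proof.
move=> yd vf; have vs t : symmetric_mx (lTheta v t) by have [] := vf t.
under [X in _ = _ + X + _ + _]eq_bigr => t _ do rewrite (inner_slack _ yd (vs t)).
rewrite /lagrangian_real /lifted_real.
under [X in _ - X - _ - _ = _]eq_bigr do rewrite inner_mxBr.
under [X in _ - X - _ = _]eq_bigr do rewrite inner_mxBr.
under [X in _ - X = _]eq_bigr do rewrite inner_mxBr.
rewrite !(sumrB, big_split) /= !mulr_sumr sum_inner_diff_time.
by ring.
Qed.

(** The trace ignores the antisymmetric part, so the [eps] term of the objective is the slack block
    of the split Lagrangian at [Theta = eps I]. *)
Lemma dual_objE y : dual_dom y ->
  dual_obj X eps l2 l3 y =
  \sum_(t < T) (- 2^-1 * inner_mx (dW y t) (dW y t))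
  + \sum_(t < T) inner_mx (dual_slack X y t) eps%:M
  + \sum_(t < T.-1) calG T l2 l3 (frobenius (dZ y t)).
Proof.
move=> [yY _]; rewrite /dual_obj mulr_sumr; congr (_ + _ + _).
apply: eq_bigr => t _; rewrite inner_mx_scalar /dual_slack !(mxtraceD, raddfN) /=.
congr (_ * (_ + _ + _)); rewrite -[RHS]mul1r -inner_mx_scalar inner_Sym_part.
  by rewrite inner_mx_scalar mul1r.
exact: symmetric_scalar.
Qed.

Lemma feasible_scalar : feasible ((fun=> eps%:M) : 'I_T -> 'M[R]_p).
Proof.
move=> t; apply/loewner_ge_sub; split; try exact: symmetric_scalar.
by rewrite subrr; have := @psd_scalar R p _ (lexx 0); rewrite raddf0.
Qed.

(** The pairing of the slack with [Theta - eps I] is kept rather than bounded by zero: weak duality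
    drops it, while the existence proof extracts a trace bound from it. *)
Lemma dual_obj_gap_le v y : dual_dom y ->
  (forall t i j, i != j -> `|dY y t i j| <= l1 * T%:R) -> feasible (lTheta v) ->
  dual_obj X eps l2 l3 y +
    \sum_(t < T) inner_mx (dual_slack X y t) (lTheta v t - eps%:M) <= L v y.
Proof.
move=> yd yY vf; rewrite dual_objE // lagrangian_split //.
under [X in _ + X <= _]eq_bigr do rewrite inner_mxBr.
rewrite sumrB.
(* The constant [eps] pairing cancels, and the four blocks are compared one by one; the [0] stands
   opposite the [Upsilon] block. *)
have -> (a b c d : R) : a + b + c + (d - b) = a + d + 0 + c by ring.
apply: lerD; first apply: lerD; first apply: lerD.
- apply: ler_sum => t _; have := inner_mx_ge0 (lU v t - dW y t).
  rewrite inner_mxBr !inner_mxBl (inner_mxC (lU v t) (dW y t)); lra.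
- by [].
- apply: sumr_ge0 => t _; apply: norm1_inner_ge0; first exact: yd.1.
  exact: yY.
- apply: ler_sum => t _.
  have h := calG_le l2_gt0 T_gt0 l3_ge (frobenius_ge0 (dZ y t)) (frobenius_ge0 (lD v t)).
  apply: le_trans h _; rewrite lerD2l.
  have := frobenius_cauchy (dZ y t) (- lD v t); rewrite inner_mxNr frobeniusN; lra.
Qed.

Lemma dual_obj_le_lagrangian v y : dual_dom y -> dual_constraints X l1 y ->
  feasible (lTheta v) -> dual_obj X eps l2 l3 y <= L v y.
Proof.
move=> yd [ys yY] vf; apply: le_trans (dual_obj_gap_le yd yY vf).
rewrite lerDl sumr_ge0 // => t _; apply: inner_psd_ge0 => //.
by have /loewner_ge_sub[] := vf t.
Qed.

(** Cauchy-Schwarz is an equality for the multiple of [Z] of norm [r] pointing against [Z]. If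
    [Z = 0], a multiple of the identity, nonzero as [p] is positive, provides the norm [r]. *)
Lemma calG_minimizer (Z : 'M[R]_p) : symmetric_mx Z -> exists D : 'M[R]_p,
  symmetric_mx D /\
  calG T l2 l3 (frobenius Z) = l2 * T%:R * calR l3 (frobenius D) + inner_mx Z D.
Proof.
move=> Zs; have [r r0 ->] := calG_attained l2_gt0 T_gt0 l3_ge (frobenius_ge0 Z).
have := frobenius_ge0 Z; rewrite le_eqVlt => /predU1P[Z0|Z0].
  have Q0 : 0 < frobenius (1%:M : 'M[R]_p).
    rewrite lt_neqAle frobenius_ge0 andbT; apply/negP => /eqP/esym/frobenius_eq0.
    move/matrixP/(_ (Ordinal p_gt0) (Ordinal p_gt0)); rewrite !mxE eqxx => /eqP.
    by rewrite oner_eq0.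
  exists ((r / frobenius (1%:M : 'M[R]_p)) *: 1%:M); split.
    exact: symmetricZ (symmetric_scalar _).
  rewrite (frobenius_eq0 (esym Z0)) inner_mx0l frobenius0 mul0r subr0 addr0.
  rewrite frobeniusZ ger0_norm ?divfK ?gt_eqF //.
  by rewrite divr_ge0 ?frobenius_ge0.
exists ((- r / frobenius Z) *: Z); split; first exact: symmetricZ.
rewrite frobeniusZ inner_mxZr -frobenius_sqr normrM normrN normfV.
rewrite !ger0_norm ?frobenius_ge0 // divfK ?gt_eqF //; congr (_ + _).
by field; rewrite gt_eqF.
Qed.

Lemma dual_obj_attained y : dual_dom y -> exists v,
  [/\ lifted_dom v, feasible (lTheta v) & L v y = dual_obj X eps l2 l3 y].
Proof.
move=> yd; have /choice[D hD] : forall t, exists D : 'M[R]_p, symmetric_mx D /\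
    calG T l2 l3 (frobenius (dZ y t)) =
    l2 * T%:R * calR l3 (frobenius D) + inner_mx (dZ y t) D.
  by move=> t; apply: calG_minimizer; apply: yd.2.
pose v := LiftedVar (fun=> eps%:M) (dW y) (fun=> 0) D.
exists v; split; first by split=> t /=; [exact: sym_off0|apply: (hD t).1].
  exact: feasible_scalar.
rewrite lagrangian_split ?dual_objE //; last exact: feasible_scalar.
rewrite [X in _ + X + _]big1 => [|t _]; last first.
  by rewrite /= norm1_off0 inner_mx0r mulr0 addr0.
rewrite addr0; congr (_ + _ + _); apply: eq_bigr => t _ /=; first by field.
by rewrite (hD t).2.
Qed.

Lemma dual_function_feasible y : dual_dom y -> dual_constraints X l1 y ->
  dual_function X eps l1 l2 l3 y = (dual_obj X eps l2 l3 y)%:E.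
Proof.
move=> yd yc; apply/eqP; rewrite eq_le; apply/andP; split.
  have [v [vd vf <-]] := dual_obj_attained yd.
  by apply: ereal_inf_lbound; exists v => //; rewrite lagrangian_fin.
apply: le_ereal_inf_tmp => _ [v vd <-].
have [vf|vf] := pselect (feasible (lTheta v)); last by rewrite lagrangian_pinfty ?leey.
by rewrite lagrangian_fin // lee_fin dual_obj_le_lagrangian.
Qed.

(** Common end of both infeasible cases: linear decrease along a ray of feasible points passes below
    every real [r], at parameter [|r - b| / - k]. *)
Lemma dual_function_ray y b k : k < 0 ->
  (forall s, 0 <= s -> exists v,
     [/\ lifted_dom v, feasible (lTheta v) & L v y <= b + s * k]) ->
  dual_function X eps l1 l2 l3 y = -oo%E.
Proof.
move=> k0 ray; apply: eq_ninfty => r.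
have [|v [vd vf vr]] := ray (`|r - b| / - k).
  by rewrite divr_ge0 // oppr_ge0 ltW.
apply: ereal_inf_le; exists (lagrangian X eps l1 l2 l3 v y); first by exists v.
rewrite lagrangian_fin // lee_fin (le_trans vr) //.
have -> : `|r - b| / - k * k = - `|r - b| by field; rewrite lt_eqF.
by have := ler_norm (- (r - b)); rewrite normrN; lra.
Qed.

Lemma calR0 : calR l3 0 = 0 :> R.
Proof.
rewrite /calR normr0 ifT //; apply: le_trans l3_ge; lra.
Qed.

(** If the slack form is negative at [x], move [Theta_t] along [x *m x^T]; if an entry of [Y_t] is
    too large, move [Upsilon_t] against its sign. All other blocks contribute a constant. *)
Lemma dual_function_infeasible y : dual_dom y -> ~ dual_constraints X l1 y ->
  dual_function X eps l1 l2 l3 y = -oo%E.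
Proof.
move=> yd /not_andP[/existsNP[t]|/existsNP[t /existsNP[i /existsNP[j /not_implyP[ij]]]]].
  move=> /loewner_ge0P/not_andP[|/existsNP[x /negP]]; first by have := symmetric_slack t yd.
  rewrite -ltNge /bilin quadE inner_mxC => k0.
  apply: (dual_function_ray (b := \sum_s inner_mx (dual_slack X y s) eps%:M) k0) => c c0.
  pose v := LiftedVar (fun s => eps%:M + (if s == t then c *: (x *m x^T) else 0))
              (fun=> 0) (fun=> 0) (fun=> 0) : lifted_var R p T.
  have vf : feasible (lTheta v).
    move=> s; apply/loewner_ge_sub; rewrite /= addrAC subrr add0r; split.
    - by apply: symmetricD; [exact: symmetric_scalar|case: ifP => _;
        [exact: symmetricZ (symmetric_outer _)|exact: symmetric0]].
    - exact: symmetric_scalar.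
    - case: ifP => _; first exact: loewner_geZ (outer_ge0 _).
      by have := @psd_scalar R p _ (lexx 0); rewrite raddf0.
  exists v; split=> //; first by split=> s; [exact: sym_off0|exact: symmetric0].
  rewrite lagrangian_split // big1 => [|s _]; last by rewrite /= !inner_mx0r mulr0 subrr.
  rewrite add0r [X in _ + X + _]big1 => [|s _]; last first.
    by rewrite /= norm1_off0 inner_mx0r mulr0 addr0.
  rewrite addr0 [X in _ + X]big1 => [|s _]; last first.
    by rewrite /= frobenius0 calR0 inner_mx0r mulr0 addr0.
  rewrite addr0 /=; under eq_bigr do rewrite inner_mxDr.
  rewrite big_split lerD2l /= (bigD1 t) //= eqxx inner_mxZr.
  by rewrite big1 ?addr0 // => s /negbTE ->; rewrite inner_mx0r.
move=> /negP; rewrite -ltNge => Yij.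
(* The factor 2 counts the positions [(i, j)] and [(j, i)], moved together to keep [Upsilon_t]
   symmetric. *)
have k0 : 2 * (l1 * T%:R - `|dY y t i j|) < 0 by lra.
apply: (dual_function_ray (b := \sum_s inner_mx (dual_slack X y s) eps%:M) k0) => c c0.
pose E : 'M[R]_p := delta_mx i j + delta_mx j i.
have Eo : sym_off_mx E.
  split=> [|k]; first by rewrite /symmetric_mx linearD /= !trmx_delta addrC.
  rewrite !mxE; have [->|_] := eqVneq k i; first by rewrite (negbTE ij) addr0.
  by rewrite andbF addr0.
pose Q := - (c * Num.sg (dY y t i j)) *: E.
pose v := LiftedVar (fun=> eps%:M)
            (fun=> 0) (fun s => if s == t then Q else 0) (fun=> 0) : lifted_var R p T.
exists v; split; last first.
  rewrite lagrangian_split //; last exact: feasible_scalar.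
  rewrite big1 => [|s _]; last by rewrite /= !inner_mx0r mulr0 subrr.
  rewrite add0r [X in _ + _ + X]big1 => [|s _]; last first.
    by rewrite /= frobenius0 calR0 inner_mx0r mulr0 addr0.
  rewrite addr0 lerD2l (bigD1 t) //= eqxx big1 => [|s /negbTE ->]; last first.
    by rewrite norm1_off0 inner_mx0r mulr0 addr0.
  rewrite addr0 norm1_offZ inner_mxZr inner_mxDr !inner_delta.
  have -> : dY y t j i = dY y t i j by have [+ _] := yd.1 t => {1}<-; rewrite mxE.
  have E2 : norm1_off E <= 2.
    rewrite (le_trans (norm1_off_triangle _ _)) // !norm1_off_delta //.
    by rewrite eq_sym.
  have Y0 : dY y t i j != 0.
    rewrite -normr_gt0; apply: lt_trans Yij; by rewrite mulr_gt0 ?ltr0n.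
  rewrite normrN normrM normr_sg Y0 mulr1 ger0_norm //.
  have -> : - (c * Num.sg (dY y t i j)) * (dY y t i j + dY y t i j) =
    - (2 * c * `|dY y t i j|) by rewrite [in RHS]normrEsg; ring.
  have : c * (l1 * T%:R) * norm1_off E <= c * (l1 * T%:R) * 2.
    by apply: ler_wpM2l => //; rewrite mulr_ge0 // mulr_ge0 // ltW.
  lra.
- exact: feasible_scalar.
- split=> s /=; last exact: symmetric0.
  by case: ifP => _; [exact: sym_offZ|exact: sym_off0].
Qed.

End Dual.

(** * Strong duality *)

Section StrongDuality.
Context {R : realType} {p T : nat}.
Variables (X : 'I_T -> 'cV[R]_p) (eps l1 l2 l3 : R).
Hypotheses (p_gt0 : (0 < p)%N) (T_gt0 : (0 < T)%N) (eps_gt0 : 0 < eps)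
  (l1_gt0 : 0 < l1) (l2_gt0 : 0 < l2) (l3_ge : 2^-1 <= l3).
Implicit Types (v w : lifted_var R p T) (y : dual_var R p T) (Theta : 'I_T -> 'M[R]_p).

Local Notation S t := (sqrt_mx (X t *m (X t)^T)).
Local Notation feasible := (primal_feasible eps).
Local Notation L := (lagrangian_real X l1 l2 l3).
Local Notation F := (lifted_real l1 l2 l3).

Definition lift Theta : lifted_var R p T :=
  LiftedVar Theta (fun t => S t *m Theta t) (fun t => offdiag (Theta t))
            (diff_time Theta).

(** The root squares to [X_t X_t^T], and cyclicity of the trace moves the symmetric factors
    [Theta_t] together. *)
Lemma lifted_real_lift Theta : feasible Theta ->
  F (lift Theta) = primal_obj X l1 l2 l3 Theta.
Proof.
move=> Tf; rewrite /lifted_real /primal_obj; congr (_ + _ * _ + _).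
  apply: eq_bigr => t _ /=; have [Ts _ _] := Tf t; have [[Ss _ _] SS] := sqrt_outerP (X t).
  move: (sqrt_mx _) Ss SS => Q Qs <-.
  congr (_ - _); rewrite /inner_mx trmx_mul Qs Ts -scalemxAl mxtraceZ; congr (_ * _).
  by rewrite -[in RHS]mulmxA [RHS]mxtrace_mulC !mulmxA.
by apply: eq_bigr => t _; rewrite norm1_off_offdiag.
Qed.

Lemma lagrangian_lift Theta y : L (lift Theta) y = F (lift Theta).
Proof.
rewrite /lagrangian_real !big1 ?subr0 // => t _; exact: etrans (congr1 _ (subrr _)) (inner_mx0r _).
Qed.

Lemma weak_duality Theta y : dual_feasible X l1 y -> feasible Theta ->
  dual_obj X eps l2 l3 y <= primal_obj X l1 l2 l3 Theta.
Proof.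
move=> [yd yc] Tf; rewrite -lifted_real_lift // -(lagrangian_lift _ y).
exact: dual_obj_le_lagrangian.
Qed.

Definition lifted_comb a b v w : lifted_var R p T :=
  LiftedVar (fun t => a *: lTheta v t + b *: lTheta w t)
            (fun t => a *: lU v t + b *: lU w t)
            (fun t => a *: lUpsilon v t + b *: lUpsilon w t)
            (fun t => a *: lD v t + b *: lD w t).

Lemma feasible_comb a b v w : 0 <= a -> 0 <= b -> a + b = 1 ->
  feasible (lTheta v) -> feasible (lTheta w) -> feasible (lTheta (lifted_comb a b v w)).
Proof.
move=> a0 b0 ab vf wf t; have /loewner_ge_sub[vs es vp] := vf t.
have /loewner_ge_sub[ws _ wp] := wf t; apply/loewner_ge_sub => /=; split=> //.
  by apply: symmetricD; exact: symmetricZ.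
rewrite -[eps%:M]scale1r -ab scalerDl opprD addrACA -!scalerBr.
by apply: loewner_geD; exact: loewner_geZ.
Qed.

Lemma lifted_real_convex a b v w : 0 <= a -> 0 <= b -> a + b = 1 ->
  F (lifted_comb a b v w) <= a * F v + b * F w.
Proof.
move=> a0 b0 ab; rewrite /lifted_real.
have -> (x y z x' y' z' c d : R) : a * (x + c * y + d * z) + b * (x' + c * y' + d * z') =
  (a * x + b * x') + c * (a * y + b * y') + d * (a * z + b * z') by ring.
apply: lerD; first apply: lerD; rewrite ?ler_wpM2l ?mulr_ge0 ?(ltW l1_gt0) ?(ltW l2_gt0) //;
  rewrite !mulr_sumr -big_split; apply: ler_sum => t _ /=.
- have := inner_mx_ge0 (lU v t - lU w t); rewrite inner_mxBr !inner_mxBl.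
  rewrite !inner_mxDr !inner_mxDl !inner_mxZr !inner_mxZl mxtraceD !mxtraceZ.
  rewrite (inner_mxC (lU w t) (lU v t)).
  move: (inner_mx _ _) (inner_mx _ _) (inner_mx _ _) => r s q h.
  (* The convexity defect of the quadratic block is [a b / 2] times the squared distance of the two
     [U]. *)
  have := mulr_ge0 (mulr_ge0 a0 b0) h; rewrite (_ : b = 1 - a); lra.
- by rewrite (le_trans (norm1_off_triangle _ _)) // !norm1_offZ !ger0_norm.
- apply: calR_convex; rewrite ?frobenius_ge0 //.
  by rewrite (le_trans (frobenius_triangle _ _)) // !frobeniusZ !ger0_norm.
Qed.

(** One real coordinate per matrix entry of each equality constraint; the three summands belong to
    [W], [Y] and [Z]. *)
Let I : finType := ('I_T * 'I_p * 'I_p + 'I_T * 'I_p * 'I_p + 'I_T.-1 * 'I_p * 'I_p)%type.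

Definition residual v (x : I) : R :=
  match x with
  | inl (inl x) => (lU v x.1.1 - S x.1.1 *m lTheta v x.1.1) x.1.2 x.2
  | inl (inr x) => (offdiag (lTheta v x.1.1) - lUpsilon v x.1.1) x.1.2 x.2
  | inr x => (diff_time (lTheta v) x.1.1 - lD v x.1.1) x.1.2 x.2
  end.

Lemma sum_triple (n : nat) (c : 'I_n * 'I_p * 'I_p -> R) (A : 'I_n -> 'M[R]_p) :
  \sum_x c x * A x.1.1 x.1.2 x.2 =
  \sum_t inner_mx (\matrix_(i, j) c (t, i, j)) (A t).
Proof.
under [RHS]eq_bigr do rewrite inner_mxE.
rewrite pair_bigA pair_bigA /=; apply: eq_bigr => -[[t i] j] _ /=.
by rewrite mxE.
Qed.

Lemma residual_comb a b v w : residual (lifted_comb a b v w) =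
  (fun x => a * residual v x + b * residual w x).
Proof.
apply: funext => -[[|]|] [[t i] j] /=.
- rewrite mulmxDr -!scalemxAr !mxE; ring.
- by rewrite !mxE; case: ifP => _; ring.
- by rewrite !mxE; ring.
Qed.

(** With [Theta = eps I] fixed, [U], [Upsilon] and [D] absorb any prescribed residual. *)
Lemma residual_surj (u : I -> R) : exists2 v, feasible (lTheta v) & residual v = u.
Proof.
exists (LiftedVar (fun=> eps%:M)
  (fun t => S t *m eps%:M + \matrix_(i, j) u (inl (inl (t, i, j))))
  (fun t => offdiag eps%:M - \matrix_(i, j) u (inl (inr (t, i, j))))
  (fun t => eps%:M - eps%:M - \matrix_(i, j) u (inr (t, i, j)))).
  exact: feasible_scalar.
apply: funext => -[[|]|] [[t i] j] /=.
- by rewrite addrAC subrr add0r mxE.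
- by rewrite opprB addrC subrK mxE.
- by rewrite /diff_time opprB addrC subrK mxE.
Qed.

Lemma residual0 v : residual v = (fun=> 0) -> v = lift (lTheta v).
Proof.
case: v => Theta U Ups D rv; rewrite /lift /=; congr LiftedVar; apply: funext => t.
- apply: subr0_eq; apply/matrixP => i j; rewrite [RHS]mxE.
  exact: (congr1 (@^~ (inl (inl (t, i, j)))) rv).
- apply/esym/subr0_eq/matrixP => i j; rewrite [RHS]mxE.
  exact: (congr1 (@^~ (inl (inr (t, i, j)))) rv).
- apply/esym/subr0_eq/matrixP => i j; rewrite [RHS]mxE.
  exact: (congr1 (@^~ (inr (t, i, j))) rv).
Qed.

(* A multiplier is a subgradient at 0 of the perturbed optimal value, seen as a
   function of the residual of the equality constraints. *)
Lemma multiplier_exists m :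
  (forall Theta, feasible Theta -> m <= primal_obj X l1 l2 l3 Theta) ->
  exists y, dual_dom y /\
    forall v, lifted_dom v -> feasible (lTheta v) -> m <= L v y.
Proof.
move=> hm.
(* Membership in [lifted_dom] is left out so that nonsymmetric residuals are reached too; at
   residual zero the point is a [lift] in any case. *)
pose C (u : I -> R) r := exists v, [/\ feasible (lTheta v), residual v = u & F v - m <= r].
have [|u|r [v [vf /residual0 ve vr]]|c hc] := @convex_support R I C.
- move=> u u' r q a b [v [vf <- vr]] [w [wf <- wq]] a0 b0 ab.
  exists (lifted_comb a b v w); split.
  + by apply: feasible_comb => //; exact: ltW.
  + exact: residual_comb.
  + have := lifted_real_convex v w (ltW a0) (ltW b0) ab.
    have := ler_wpM2l (ltW a0) vr; have := ler_wpM2l (ltW b0) wq.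
    rewrite (_ : b = 1 - a); lra.
- by have [v vf ve] := residual_surj u; exists (F v - m), v; split.
- apply: le_trans vr; rewrite subr_ge0 ve lifted_real_lift ?hm //.
(* The [Y] and [Z] parts of the functional are projected into [dual_dom]. Pairings with residuals of
   feasible points of [lifted_dom] do not change, since these residuals already have the required
   symmetry and, for [Y], zero diagonal. *)
pose y := DualVar (fun t => \matrix_(i, j) c (inl (inl (t, i, j))))
  (fun t => offdiag (Sym_part (\matrix_(i, j) c (inl (inr (t, i, j))))))
  (fun t => Sym_part (\matrix_(i, j) c (inr (t, i, j)))).
exists y; split.
  split=> t /=; last exact: symmetric_Sym_part.
  exact: sym_off_offdiag (symmetric_Sym_part _).
move=> v vd vf; have := hc (residual v) (F v - m); rewrite !big_sumType /=.
have -> : L v y = F v - (\sum_t inner_mx (\matrix_(i, j) c (inl (inl (t, i, j))))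
     (lU v t - S t *m lTheta v t) +
   \sum_t inner_mx (\matrix_(i, j) c (inl (inr (t, i, j))))
     (offdiag (lTheta v t) - lUpsilon v t) +
   \sum_t inner_mx (\matrix_(i, j) c (inr (t, i, j)))
     (diff_time (lTheta v) t - lD v t)).
  rewrite /lagrangian_real 2!opprD 2!addrA; congr (_ - _ - _ - _).
    apply: eq_bigr => t _ /=.
    have bo : sym_off_mx (offdiag (lTheta v t) - lUpsilon v t).
      rewrite -scaleN1r; apply: sym_offD; last exact/sym_offZ/vd.1.
      by apply: sym_off_offdiag; have [] := vf t.
    by rewrite inner_offdiag (offdiag_id bo) inner_Sym_part //; exact: symmetric_sym_off.
  apply: eq_bigr => t _ /=; rewrite inner_Sym_part //.
  apply: symmetricD (symmetricN (vd.2 t)); apply: symmetricD (symmetricN _).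
    by have [] := vf (ord_next t).
  by have [] := vf (ord_cur t).
rewrite -(sum_triple (c \o inl \o inl) (fun t => lU v t - S t *m lTheta v t)).
rewrite -(sum_triple (c \o inl \o inr) (fun t => offdiag (lTheta v t) - lUpsilon v t)).
rewrite -(sum_triple (c \o inr) (fun t => diff_time (lTheta v) t - lD v t)).
have Cv : C (residual v) (F v - m) by exists v; split.
by move=> /(_ Cv); rewrite lerBrDr -lerBrDl.
Qed.

(** Weak duality is one inequality. For the other, [Theta = eps I] keeps the primal value below
    [+oo], the value [-oo] is trivial, and a real value [m] yields a multiplier with dual function
    at least [m]. *)
Lemma primal_dual_value :
  primal_value X eps l1 l2 l3 = dual_value X eps l1 l2 l3.
Proof.
apply/eqP; rewrite eq_le andbC; apply/andP; split.
  apply: ge_ereal_sup => _ [y yf <-].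
  apply: le_ereal_inf_tmp => _ [A Af <-].
  by rewrite lee_fin weak_duality.
have : (primal_value X eps l1 l2 l3 < +oo)%E.
  apply: (@le_lt_trans _ _ (primal_obj X l1 l2 l3 (fun=> eps%:M))%:E); last exact: ltry.
  by apply: ereal_inf_lbound; exists (fun=> eps%:M) => //; exact: feasible_scalar.
case pE : (primal_value X eps l1 l2 l3) => [m| |] // _; last by rewrite leNye.
have [|y [yd hy]] := @multiplier_exists m.
  move=> Theta Tf; rewrite -lee_fin -pE; apply: ereal_inf_lbound.
  by exists Theta.
have mdual : (m%:E <= dual_function X eps l1 l2 l3 y)%E.
  apply: le_ereal_inf_tmp => _ [v vd <-].
  have [vf|vf] := pselect (feasible (lTheta v)); last by rewrite lagrangian_pinfty ?leey.
  by rewrite lagrangian_fin // lee_fin hy.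
(* A multiplier violating the constraints would have dual function [-oo], below [m]. *)
have [yc|yc] := pselect (dual_constraints X l1 y); last first.
  by move: mdual; rewrite dual_function_infeasible.
apply: le_trans mdual _; rewrite dual_function_feasible //.
by apply: ereal_sup_ubound; exists y.
Qed.

End StrongDuality.

(** * Slater points and primal solutions *)

Section MatrixContinuity.
Context {R : realType} {U : topologicalType} {p : nat}.
Implicit Types (f g : U -> R) (A B : U -> 'M[R]_p).

Lemma continuous_add f g : continuous f -> continuous g ->
  continuous (fun x => f x + g x).
Proof. by move=> fc gc x; apply: (@continuousD R R^o U f g x (fc x) (gc x)). Qed.

Lemma continuous_mul f g : continuous f -> continuous g ->
  continuous (fun x => f x * g x).
Proof. by move=> fc gc x; apply: (@continuousM R U f g x (fc x) (gc x)). Qed.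

Lemma continuous_const (c : R) : continuous ((fun=> c) : U -> R).
Proof. exact: cst_continuous. Qed.

Lemma continuous_opp f : continuous f -> continuous (fun x => - f x).
Proof.
move=> fc; rewrite (_ : (fun x => - f x) = fun x => -1 * f x).
  by apply: continuous_mul => //; exact: continuous_const.
by apply: funext => x; rewrite mulN1r.
Qed.

Lemma continuous_sum (I : Type) (r : seq I) (P : pred I) (F : I -> U -> R) :
  (forall i, continuous (F i)) -> continuous (fun x => \sum_(i <- r | P i) F i x).
Proof.
move=> Fc; apply: continuous_big => // ab.
exact: (@add_continuous R^o ab).
Qed.

Lemma continuous_norm f : continuous f -> continuous (fun x => `|f x|).
Proof.
by move=> fc x; apply: (@continuous_comp U R R f Num.norm x (fc x)); exact: norm_continuous.
Qed.

Lemma continuous_sqrt f : continuous f -> continuous (fun x => Num.sqrt (f x)).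
Proof.
by move=> fc x; apply: (@continuous_comp U R R f Num.sqrt x (fc x)); exact: sqrt_continuous.
Qed.

Lemma continuous_posp f : continuous f -> continuous (fun x => posp (f x)).
Proof.
move=> fc x; apply: (@continuous_max R U f (fun=> 0) x (fc x)).
exact: continuous_const.
Qed.

Definition continuous_mx (m n : nat) (A : U -> 'M[R]_(m, n)) : Prop :=
  forall i j, continuous (fun x => A x i j).

Lemma continuous_mx_const m n (A : 'M[R]_(m, n)) : continuous_mx (fun=> A).
Proof. by move=> i j; exact: continuous_const. Qed.

Lemma continuous_mx_mul m n k (A : U -> 'M[R]_(m, n)) (B : U -> 'M[R]_(n, k)) :
  continuous_mx A -> continuous_mx B -> continuous_mx (fun x => A x *m B x).
Proof.
move=> Ac Bc i j; under eq_fun do rewrite mxE.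
by apply: continuous_sum => l; exact: continuous_mul.
Qed.

Lemma continuous_mx_sub A B : continuous_mx A -> continuous_mx B ->
  continuous_mx (fun x => A x - B x).
Proof.
move=> Ac Bc i j; under eq_fun do rewrite !mxE.
by apply: continuous_add => //; exact: continuous_opp.
Qed.

Lemma continuous_mx_scale a A : continuous_mx A -> continuous_mx (fun x => a *: A x).
Proof.
move=> Ac i j; under eq_fun do rewrite mxE.
by apply: continuous_mul => //; exact: continuous_const.
Qed.

Lemma continuous_mxtrace A : continuous_mx A -> continuous (fun x => \tr (A x)).
Proof. by move=> Ac; apply: continuous_sum => i. Qed.

Lemma continuous_frobenius A : continuous_mx A -> continuous (fun x => frobenius (A x)).
Proof.
move=> Ac; apply/continuous_sqrt/continuous_sum => i; apply: continuous_sum => j.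
under eq_fun do rewrite expr2; exact: continuous_mul.
Qed.

Lemma continuous_norm1_off A : continuous_mx A -> continuous (fun x => norm1_off (A x)).
Proof.
move=> Ac; apply: continuous_sum => i; apply: continuous_sum => j.
exact: continuous_norm.
Qed.

(** The form [calRE] is built from continuous operations, so the two pieces need no gluing at
    [l]. *)
Lemma continuous_calR l f : 2^-1 <= l -> continuous f ->
  continuous (fun x => calR l (f x)).
Proof.
move=> l2 fc; under eq_fun do rewrite calRE // expr2.
have pc : continuous (fun x => posp (`|f x| - l)).
  apply/continuous_posp/continuous_add; [exact: continuous_norm|exact: continuous_const].
apply: continuous_add; first exact: continuous_norm.
apply: continuous_add; first exact: continuous_mul.
by apply: continuous_mul => //; exact: continuous_const.
Qed.

(** An intersection of closed conditions: one equation per pair of entries for symmetry, one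
    inequality per vector. A nonsymmetric [B] gives the empty set. *)
Lemma closed_loewner_ge A (B : 'M[R]_p) : continuous_mx A ->
  closed [set x | loewner_ge (A x) B].
Proof.
move=> Ac; have [Bs|Bs] := pselect (symmetric_mx B); last first.
  by rewrite (_ : [set x | _] = set0); [exact: closed0|apply/seteqP; split=> x // -[]].
rewrite (_ : [set x | _] =
    (\bigcap_(ij in [set: 'I_p * 'I_p])
       (fun x => A x ij.2 ij.1 - A x ij.1 ij.2) @^-1` [set 0]) `&`
    (\bigcap_(z in [set: 'cV[R]_p])
       (fun x => (z^T *m (A x - B) *m z) 0 0) @^-1` [set a | 0 <= a])).
  apply: closedI; apply: closed_bigI => z _; apply: preimage_closed.
  - move=> x _; by apply: continuous_add => //; exact: continuous_opp.
  - exact: closed_eq.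
  - move=> x _; apply: continuous_mx_mul; last exact: continuous_mx_const.
    apply: continuous_mx_mul; first exact: continuous_mx_const.
    by apply: continuous_mx_sub => //; exact: continuous_mx_const.
  - exact: closed_ge.
apply/seteqP; split=> x /=.
  move=> [As _ Ap]; split=> [[i j] _ /=|z _ /=]; last exact: Ap.
  by rewrite -{1}As mxE subrr.
move=> [As Ap]; split=> // [|z]; last exact: Ap.
by apply/matrixP => i j; rewrite mxE; apply/subr0_eq/(As (i, j)).
Qed.

End MatrixContinuity.

(** * Compactness, strict dual feasibility and attainment *)

Section Existence.
Context {R : realType} {p T : nat}.
Variables (X : 'I_T -> 'cV[R]_p) (eps l1 l2 l3 : R).
Hypotheses (p_gt0 : (0 < p)%N) (T_gt0 : (0 < T)%N) (eps_gt0 : 0 < eps)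
  (l1_gt0 : 0 < l1) (l2_gt0 : 0 < l2) (l3_ge : 2^-1 <= l3).
Implicit Types (A : 'I_T -> 'M[R]_p) (y : dual_var R p T).

Local Notation S t := (sqrt_mx (X t *m (X t)^T)).
Local Notation feasible := (primal_feasible eps).
Local Notation obj := (primal_obj X l1 l2 l3).
Local Notation index := ('I_T * 'I_p * 'I_p)%type.

(** Flattening a family of matrices to one row vector gives access to compact boxes and the extreme
    value theorem. *)
Definition family_of_row (x : 'rV[R]_#|{: index}|) : 'I_T -> 'M[R]_p :=
  fun t => \matrix_(i, j) x 0 (enum_rank (t, i, j)).

Lemma family_of_row_surj A : exists x, family_of_row x = A.
Proof.
exists (\row_k A (enum_val k).1.1 (enum_val k).1.2 (enum_val k).2).
by apply: funext => t; apply/matrixP => i j; rewrite !mxE enum_rankK.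
Qed.

Lemma continuous_family_of_row t : continuous_mx (family_of_row ^~ t).
Proof.
move=> i j; under eq_fun do rewrite mxE; exact: coord_continuous.
Qed.

Lemma continuous_primal_obj : continuous (obj \o family_of_row).
Proof.
have Fc := continuous_family_of_row.
apply: continuous_add; first apply: continuous_add.
- apply: continuous_sum => t; apply: continuous_add; last first.
    exact/continuous_opp/continuous_mxtrace.
  apply/continuous_mxtrace/continuous_mx_mul; last exact: continuous_mx_const.
  exact/continuous_mx_scale/continuous_mx_mul.
- apply: continuous_mul; [exact: continuous_const|apply: continuous_sum => t].
  exact: continuous_norm1_off.
- apply: continuous_mul; [exact: continuous_const|apply: continuous_sum => t].
  by apply: continuous_calR => //; apply/continuous_frobenius/continuous_mx_sub.
Qed.

(** The sublevel set of [eps I] lies in a compact box of feasible points. A minimiser on that box is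
    global, since every feasible point outside the sublevel set is worse than [eps I]. *)
Lemma primal_optimal_exists (b : R) :
  (forall A, feasible A -> obj A <= obj (fun=> eps%:M) ->
     forall t i j, `|A t i j| <= b) ->
  exists A, primal_optimal X eps l1 l2 l3 A.
Proof.
move=> hb.
pose K := [set x | feasible (family_of_row x) /\
                   forall k, x ord0 k \in `[(- b), b]].
have Kc : compact K.
  rewrite (_ : K = [set x | feasible (family_of_row x)] `&`
                   [set x | forall k, `[(- b), b]%classic (x ord0 k)]).
    rewrite setIC; apply: compact_closedI.
      exact: (@rV_compact R _ (fun=> `[(- b), b]%classic) (fun=> @segment_compact R _ _)).
    rewrite (_ : [set x | _] = \bigcap_(t in [set: 'I_T])
        [set x | loewner_ge (family_of_row x t) eps%:M]).
      by apply: closed_bigI => t _; apply/closed_loewner_ge/continuous_family_of_row.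
    by apply/seteqP; split=> x /= h t; [move=> _; apply: h|apply: h].
  by apply/seteqP; split=> x /=.
have inK x : feasible (family_of_row x) ->
    obj (family_of_row x) <= obj (fun=> eps%:M) -> K x.
  move=> xf /(hb _ xf) h; split=> // k.
  have := h (enum_val k).1.1 (enum_val k).1.2 (enum_val k).2.
  rewrite mxE -!surjective_pairing enum_valK ler_norml => /andP[h1 h2].
  by rewrite in_itv /= h1 h2.
have [x0 x0E] := family_of_row_surj (fun=> eps%:M).
have Kx0 : K x0 by apply: inK; rewrite x0E //; exact: feasible_scalar.
have [c + cmin] : exists2 c, c \in K &
    forall x, x \in K -> (obj \o family_of_row) c <= (obj \o family_of_row) x.
  apply: EVT_min_rV => //; first by exists x0.
  exact: continuous_subspaceT continuous_primal_obj.
rewrite inE => -[cf _]; exists (family_of_row c); split=> // A Af.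
have [x xE] := family_of_row_surj A; rewrite -xE in Af *.
have [h|h] := leP (obj (family_of_row x)) (obj (fun=> eps%:M)).
  by apply: cmin; rewrite inE; exact: inK.
by apply: le_trans (ltW h); rewrite -x0E; apply: cmin; rewrite inE.
Qed.

(* The increments of [Z] average the matrices [X_t X_t^T] out over time. *)
Lemma strong_slack_exists : loewner_gt (\sum_(t < T) X t *m (X t)^T) 0 ->
  exists y, [/\ dual_dom y, forall t, dY y t = 0
    & forall t, loewner_ge (dual_slack X y t - 1%:M) 0].
Proof.
set M := \sum_(t < T) _ => /pd_ge_scalar[c c0 Mc].
have T0 : 0 < T%:R :> R by rewrite ltr0n.
(* This gives [a / T * c = 2]: one identity absorbs the [- I] of the slack, the other is the claimed
   margin. *)
pose a := 2 * T%:R / c; have a0 : 0 < a by rewrite divr_gt0 // mulr_gt0.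
pose G t := (a / T%:R) *: M - a *: (X t *m (X t)^T).
have Gs t : symmetric_mx (G t).
  apply: symmetricD (symmetricN (symmetricZ _ (symmetric_outer _))).
  by apply/symmetricZ/symmetric_sum => s; exact: symmetric_outer.
have G0 : \sum_t G t = 0.
  rewrite sumrB sumr_const card_ord -scaler_sumr -/M -scaler_nat scalerA.
  by rewrite mulrC divfK ?subrr // gt_eqF.
pose Z (t : 'I_T.-1) := \sum_(s < T | (s <= t)%N) G s.
have zE k : (k <= T)%N -> zpad Z k = \sum_(s < T | (s < k)%N) G s.
  case: k => [_|k kT] /=; first by rewrite big1.
  case: insubP => [t _ <-|] //=; rewrite -leqNgt => Tk.
  (* Here [k.+1] equals [T]: the padding value 0 is the full sum of the increments [G], which add up
     to zero. *)
  rewrite -[LHS]G0; apply: eq_bigl => s; rewrite ltnS.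
  by symmetry; rewrite -ltnS (leq_trans (ltn_ord s)) // (leq_trans (leqSpred T)) // ltnS.
pose y := DualVar (fun t => a *: S t) (fun=> 0) Z.
have zdE t : zdiff Z t = G t.
  rewrite /zdiff !zE //; last exact: ltnW.
  rewrite (bigD1 t) //=.
  rewrite [X in _ - X](eq_bigl (fun s : 'I_T => (s < t.+1)%N && (s != t))) ?addrK // => s.
  by rewrite ltnS [LHS]ltn_neqAle andbC.
exists y; split=> // [|t].
  split=> t /=; first exact: sym_off0.
  by apply: big_ind => //; [exact: symmetric0|exact: symmetricD].
have -> : dual_slack X y t - 1%:M = (a / T%:R) *: (M - c%:M).
  rewrite /dual_slack /= zdE subr0.
  have [_ SS] := sqrt_outerP (X t).
  (* This cancels the [X_t X_t^T] term of [G t]; what remains is independent of [t]. *)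
  have -> : Sym_part (S t *m (a *: S t)) = a *: (X t *m (X t)^T).
    rewrite -scalemxAr SS /Sym_part linearZ /= symmetric_outer -scalerDl scalerA.
    by congr (_ *: _); field.
  have -> : (a / T%:R) *: (M - c%:M) = (a / T%:R) *: M - 1%:M - 1%:M.
    rewrite scalerBr scale_scalar_mx -addrA -opprD -raddfD; congr (_ - _%:M).
    by rewrite /a; field; rewrite !gt_eqF.
  by rewrite /G; congr (_ - _); rewrite addrAC subrK.
by apply: loewner_geZ => //; rewrite divr_ge0 // ltW.
Qed.

(** A slack above the identity is positive definite, and [Y = 0] lies strictly within the positive
    bound [l1 * T]. *)
Lemma dual_slater_exists : loewner_gt (\sum_(t < T) X t *m (X t)^T) 0 ->
  exists y : dual_var R p T, dual_slater X l1 y.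
Proof.
move=> /strong_slack_exists[y [yd Y0 ys]]; exists y.
have l0 : 0 < l1 * T%:R by rewrite mulr_gt0 ?ltr0n.
have slackE t x : bilin (dual_slack X y t) x x =
    bilin (dual_slack X y t - 1%:M) x x + (x^T *m x) 0 0.
  by rewrite [in RHS]bilin_mxB bilin_scalar mul1r subrK.
have ysp t x : 0 <= bilin (dual_slack X y t - 1%:M) x x.
  by have /loewner_ge0P[_] := ys t.
split; split=> //.
- split=> [t|t u v _]; last by rewrite Y0 mxE normr0 ltW.
  apply/loewner_ge0P; split=> [|x]; first exact: symmetric_slack.
  by rewrite slackE addr_ge0 // norm_sqr_ge0.
- move=> t; split; [exact: symmetric_slack|exact: symmetric0|move=> x x0].
  by rewrite subr0 -/(bilin _ x x) slackE ltr_wpDl // norm_sqr_gt0.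
- by move=> t u v _; rewrite Y0 mxE normr0.
Qed.

Lemma feasible_psd A t : feasible A -> loewner_ge (A t) 0.
Proof.
move=> Af; have /loewner_ge_sub[_ _ h] := Af t; rewrite -(subrK eps%:M (A t)).
by apply: loewner_geD h _; apply: psd_scalar; exact: ltW.
Qed.

Lemma primal_solution_exists : loewner_gt (\sum_(t < T) X t *m (X t)^T) 0 ->
  exists A, primal_optimal X eps l1 l2 l3 A.
Proof.
move=> /strong_slack_exists[y [yd Y0 ys]].
(* The bound is [dual_obj_gap_le] solved for the pairings of the slacks with [A], with [obj A]
   replaced by its bound at [eps I]. These pairings dominate the traces because each slack is above
   the identity. *)
apply: (@primal_optimal_exists (obj (fun=> eps%:M) - dual_obj X eps l2 l3 y +
  \sum_(t < T) inner_mx (dual_slack X y t) eps%:M)) => A Af Ale t i j.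
have trA s : 0 <= \tr (A s).
  by rewrite sumr_ge0 // => k _; rewrite -bilin_delta; have /loewner_ge0P[_] := feasible_psd s Af.
apply: le_trans (psd_entry_le_tr _ _ (feasible_psd t Af)) _.
apply: (@le_trans _ _ (\sum_s \tr (A s))).
  by rewrite (bigD1 t) //= lerDl sumr_ge0.
have h : dual_obj X eps l2 l3 y +
    \sum_(t < T) inner_mx (dual_slack X y t) (A t - eps%:M) <= obj A.
  rewrite -(lifted_real_lift X l1 l2 l3 Af) -(lagrangian_lift _ _ _ _ _ y).
  apply: (dual_obj_gap_le X T_gt0 l2_gt0 l3_ge (v := lift X A)) => // s u v _.
  rewrite Y0 mxE normr0.
  by rewrite mulr_ge0 // ltW.
have : \sum_s \tr (A s) <= \sum_(t < T) inner_mx (dual_slack X y t) (A t).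
  apply: ler_sum => s _; have := inner_psd_ge0 (ys s) (feasible_psd s Af).
  by rewrite inner_mxBl (inner_mxC 1%:M) inner_mx_scalar mul1r subr_ge0.
move: h; under [X in _ + X <= _]eq_bigr do rewrite inner_mxBr.
rewrite sumrB; lra.
Qed.

End Existence.

Theorem proposition4p2 (R : realType) (p T : nat) (X : 'I_T -> 'cV[R]_p)
    (eps lambda1 lambda2 lambda3 : R)
    (p_gt0 : (0 < p)%N) (T_gt0 : (0 < T)%N)
    (eps_gt0 : 0 < eps) (lambda1_gt0 : 0 < lambda1) (lambda2_gt0 : 0 < lambda2)
    (lambda3_ge : 2^-1 <= lambda3) :
  ((forall y : dual_var R p T, dual_dom y ->
      (dual_constraints X lambda1 y ->
         dual_function X eps lambda1 lambda2 lambda3 y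
           = (dual_obj X eps lambda2 lambda3 y)%:E) /\
      (~ dual_constraints X lambda1 y ->
         dual_function X eps lambda1 lambda2 lambda3 y = -oo%E)) /\
   primal_value X eps lambda1 lambda2 lambda3
     = dual_value X eps lambda1 lambda2 lambda3) /\
  (loewner_gt (\sum_(t < T) X t *m (X t)^T) 0 ->
     (exists y : dual_var R p T, dual_slater X lambda1 y) /\
     (exists Theta : 'I_T -> 'M[R]_p,
        primal_optimal X eps lambda1 lambda2 lambda3 Theta)).
Proof.
split=> [|Xpd].
  split=> [y yd|]; last exact: primal_dual_value.
  split=> yc; [exact: dual_function_feasible|exact: dual_function_infeasible].
by split; [exact: dual_slater_exists|exact: primal_solution_exists].
Qed.
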